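(* Let $a$ and $b$ be two sequences $(a_i)_{i\in\mathbb Z}$, $(b_i)_{i\in\mathbb Z}$ of integers $\ge2$ such that $\Omega_a\cong\Omega_b$ as topological groups (in which case $S_a=S_b$). Let $H$ be a nontrivial subgroup of $S_a=S_b$. Then $\overline{\mathcal Q}(a,H)\cong\overline{\mathcal Q}(b,H)$.
   Context: For a sequence $a=(a_i)_{i\in\mathbb Z}$ of integers $a_i\ge2$, let $N_a=\{\frac{j}{a_{-1}\cdots a_{-k}}: j\in\mathbb Z,\ k\ge1\}\subset\mathbb Q$ (discrete additive group). Let $\mathcal U_a$ be the family of all subgroups $\frac mn\mathbb Z$ of $N_a$ with $m,n$ positive integers such that $m$ divides $a_0\cdots a_j$ for some $j\ge0$ and $n$ divides $a_{-1}\cdots a_{-k}$ for some $k\ge1$. The group of $a$-adic numbers $\Omega_a$ is the Hausdorff completion of $N_a$ with respect to the group topology having $\mathcal U_a$ as a neighbourhood basis at $0$; it is a totally disconnected locally compact abelian group containing $N_a$ as a dense subgroup. $P_a$ is the set of primes $p$ dividing $a_k$ for infinitely many $k<0$ and for infinitely many $k\ge0$, and $S_a$ is the subgroup of the multiplicative group $\mathbb Q^\times_+$ of positive rationals generated by $P_a$. For $s\in S_a$, multiplication by $s$ is an automorphism of $N_a$ that permutes $\mathcal U_a$, hence extends by continuity to an automorphism $x\mapsto s\cdot x$ of $\Omega_a$. For a nontrivial subgroup $H\subset S_a$ (discrete), $\overline{\mathcal Q}(a,H)$ is the crossed product $C_0(\Omega_a)\rtimes_{\alpha^{\mathrm{aff}}}(N_a\rtimes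 H)$, where $H$ acts on $N_a$ by multiplication and $\alpha^{\mathrm{aff}}_{(n,h)}(f)(x)=f(h^{-1}\cdot(x-n))$. *)

(* Defs.v *)
From HB Require Import structures.
From mathcomp Require Import all_boot all_order all_algebra.
From mathcomp Require Import all_classical all_reals all_analysis.
From mathcomp Require Import complex.

Set Implicit Arguments.
Unset Strict Implicit.
Unset Printing Implicit Defensive.

Import Order.TTheory GRing.Theory Num.Theory.
Import numFieldNormedType.Exports.

Local Open Scope classical_set_scope.
Local Open Scope ring_scope.

Record adic_seq := AdicSeq {
  adic_fun :> int -> nat;
  adic_ge2 : forall i, (2 <= adic_fun i)%N }.

(* [neg_prod a k] is a_{-1} ... a_{-k}; [pos_prod a j] is a_0 ... a_j. *)
Definition neg_prod (a : adic_seq) (k : nat) : nat :=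
  (\prod_(1 <= i < k.+1) a (- i%:Z)%R)%N.
Definition pos_prod (a : adic_seq) (j : nat) : nat :=
  (\prod_(0 <= i < j.+1) a i%:Z)%N.

Definition in_N (a : adic_seq) : {pred rat} :=
  [pred q | `[< exists (j : int) (k : nat),
                 (1 <= k)%N /\ q = j%:~R / (neg_prod a k)%:R >]].

Section Adic.
Variable a : adic_seq.

Lemma neg_prod_gt0 k : (0 < neg_prod a k)%N.
Proof.
by apply: prodn_gt0 => i; apply: leq_trans (adic_ge2 a _).
Qed.

Lemma dvdn_neg_prod k l : (k <= l)%N -> (neg_prod a k %| neg_prod a l)%N.
Proof.
move=> kl; rewrite /neg_prod (@big_cat_nat _ _ _ k.+1 1 l.+1) //=.
exact: dvdn_mulr.
Qed.

Lemma in_N_dvd (j : int) (d k : nat) :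
  (d %| neg_prod a k)%N -> j%:~R / d%:R \in in_N a.
Proof.
move=> dk; have {}dk := dvdn_trans dk (dvdn_neg_prod (leqnSn k)).
apply/asboolP.
exists (j * ((neg_prod a k.+1) %/ d)%N%:Z), k.+1; split => //.
have d0 : d%:R != 0 :> rat.
  by rewrite pnatr_eq0 -lt0n; exact: dvdn_gt0 (neg_prod_gt0 k.+1) dk.
have n0 : (neg_prod a k.+1)%:R != 0 :> rat by rewrite pnatr_eq0 -lt0n neg_prod_gt0.
rewrite rmorphM /= -mulrA; congr (_ * _).
apply: (mulIf n0); rewrite mulfVK //.
by rewrite -[in LHS](divnK dk) natrM mulrC mulfK.
Qed.

Lemma in_N_zmod_closed : zmod_closed (in_N a).
Proof.
split; first by apply/asboolP; exists 0, 1%N; rewrite mul0r.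
move=> x y /asboolP[i [k [_ ->]]] /asboolP[j [l [_ ->]]].
have n0 m : (neg_prod a m)%:R != 0 :> rat by rewrite pnatr_eq0 -lt0n neg_prod_gt0.
have red (c : int) m n : (m <= n)%N ->
    exists d : int, c%:~R / (neg_prod a m)%:R = d%:~R / (neg_prod a n)%:R :> rat.
  move=> mn; exists (c * ((neg_prod a n) %/ (neg_prod a m))%N%:Z).
  rewrite rmorphM /= -mulrA; congr (_ * _).
  apply: (mulIf (n0 n)); rewrite mulfVK //.
  by rewrite -[in LHS](divnK (dvdn_neg_prod mn)) natrM mulrC mulfK.
have [c ->] := red i _ _ (leq_maxl k l); have [d ->] := red j _ _ (leq_maxr k l).
rewrite -mulrBl -rmorphB /=; exact: in_N_dvd (dvdnn _).
Qed.

HB.instance Definition _ := GRing.isZmodClosed.Build rat (in_N a) in_N_zmod_closed.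

Record adicN := AdicN { N_val :> rat; N_valP : N_val \in in_N a }.
HB.instance Definition _ := [isSub for N_val].
HB.instance Definition _ := [Choice of adicN by <:].
HB.instance Definition _ := [SubChoice_isSubZmodule of adicN by <:].

Definition adicU : set_system adicN :=
  [set V | exists m n : nat,
    [/\ (0 < m)%N /\ (0 < n)%N,
        (exists j, (m %| pos_prod a j)%N),
        (exists k, (1 <= k)%N /\ (n %| neg_prod a k)%N) &
        V = [set x | exists z : int, N_val x = z%:~R * (m%:R / n%:R)]]].

Definition adicP : set nat :=
  [set p | [/\ prime p,
    infinite_set [set k : int | (k < 0)%R /\ (p %| a k)%N] &
    infinite_set [set k : int | (0 <= k)%R /\ (p %| a k)%N]]].

End Adic.

Definition posrat_subgroup (H : set rat) : Prop :=
  [/\ H `<=` [set x | 0 < x], H 1, (forall x y, H x -> H y -> H (x * y)) &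
      (forall x, H x -> H x^-1)].

Definition adicS (a : adic_seq) : set rat :=
  smallest posrat_subgroup [set p%:R | p in adicP a].

Definition nontrivial_subgroup_of (K H : set rat) : Prop :=
  [/\ posrat_subgroup H, H `<=` K & exists2 h, H h & h != 1].

Definition cauchy_in_group (M : topologicalZmodType) (F : set_system M) : Prop :=
  forall W : set M, nbhs 0 W ->
    exists2 A, F A & forall x y, A x -> A y -> W (x - y).

(* The Hausdorff completions of the group [M] whose topology has [B] as a
   neighbourhood basis at 0; they are canonically isomorphic to each other.
   [hc_continuous] and [hc_initial] say that this topology is the initial one
   for the canonical map. *)
Record hausdorff_completion (M : zmodType) (B : set_system M) :=
  HausdorffCompletion {
    hc_sort :> topologicalZmodType;
    hc_in : {additive M -> hc_sort};
    hc_hausdorff : hausdorff_space hc_sort;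
    hc_complete : forall F : set_system hc_sort, ProperFilter F ->
      cauchy_in_group F -> exists x : hc_sort, F --> x;
    hc_dense : dense (range hc_in);
    hc_continuous : forall W : set hc_sort, nbhs 0 W ->
      exists2 V, B V & V `<=` hc_in @^-1` W;
    hc_initial : forall V, B V ->
      exists2 W : set hc_sort, nbhs 0 W & hc_in @^-1` W `<=` V }.

Definition Omega (a : adic_seq) := hausdorff_completion (@adicU a).

Definition topgroup_iso (M M' : topologicalZmodType) : Prop :=
  exists (f : {additive M -> M'}) (g : M' -> M),
    [/\ cancel f g, cancel g f, continuous f & continuous g].

Section Multiplication.
Variable a : adic_seq.

Lemma P_mul_in_N p q : adicP a p -> q \in in_N a ->
  p%:R * q \in in_N a /\ p%:R^-1 * q \in in_N a.
Proof.
move=> [pp infp _] /asboolP[j [k [_ ->]]]; split.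
  rewrite mulrA -[p%:R]/(p%:Z%:~R) -rmorphM /=; exact: in_N_dvd (dvdnn _).
have [l kl pl] : exists2 l, (k < l)%N & (p %| a (- l%:Z))%N.
  apply: contrapT => no; apply: infp.
  apply: (@sub_finite_set _ _ ((fun l : nat => - l%:Z) @` `I_k.+1)).
    move=> z [z0 pz] /=; exists `|z|%N; last by rewrite ltz0_abs // opprK.
    rewrite ltnS leqNgt; apply/negP => kz; apply: no; exists `|z|%N => //.
    by rewrite ltz0_abs // opprK.
  exact/finite_image/finite_II.
rewrite mulrCA -invfM -natrM; apply: (@in_N_dvd _ _ _ l).
case: l kl pl => // l kl pl.
have -> : neg_prod a l.+1 = (a (- l.+1%:Z) * neg_prod a l)%N.
  by rewrite mulnC /neg_prod big_nat_recr.
by apply: dvdn_mul => //; exact: dvdn_neg_prod.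
Qed.

Lemma S_mul_in_N h q : adicS a h -> q \in in_N a -> h * q \in in_N a.
Proof.
pose K := [set x : rat | [/\ 0 < x,
  (forall q, q \in in_N a -> x * q \in in_N a) &
  (forall q, q \in in_N a -> x^-1 * q \in in_N a)]].
move=> Sh; suff [_ Kh _] : K h by exact: Kh.
apply: (Sh K); split.
  split; first by move=> x [].
  - by split=> // r rN; rewrite ?invr1 mul1r.
  - move=> x y [x0 xN xVN] [y0 yN yVN]; split; first exact: mulr_gt0.
      by move=> r rN; rewrite -mulrA; apply/xN/yN.
    by move=> r rN; rewrite invfM -mulrA; apply/xVN/yVN.
  - by move=> x [x0 xN xVN]; split; rewrite ?invr_gt0 ?invrK.
move=> _ [p Pp <-]; split; first by case: Pp => /prime_gt0; rewrite ltr0n.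
  by move=> r /(P_mul_in_N Pp)[].
by move=> r /(P_mul_in_N Pp)[].
Qed.

Variables (H : set rat) (HS : nontrivial_subgroup_of (adicS a) H).

Lemma subgroup_mul_in_N h (n : adicN a) : H h -> h * N_val n \in in_N a.
Proof. by case: HS => _ HSa _ Hh; apply: S_mul_in_N (N_valP n); exact: HSa. Qed.

Definition subgroup_elt of nontrivial_subgroup_of (adicS a) H := {h : rat | `[< H h >]}.
Local Notation elt := (subgroup_elt HS).
HB.instance Definition _ := Choice.on elt.

Lemma elt_in (h : elt) : H (val h).
Proof. exact/asboolP/(valP h). Qed.

Lemma elt1_in : H 1.
Proof. by case: HS => -[]. Qed.

Lemma eltM_in (h k : elt) : H (val h * val k).
Proof. by case: HS => -[_ _ HM _] _ _; apply: HM; exact: elt_in. Qed.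

Lemma eltV_in (h : elt) : H (val h)^-1.
Proof. by case: HS => -[_ _ _ HV] _ _; apply: HV; exact: elt_in. Qed.

Definition elt1 : elt := exist _ 1 (asboolT elt1_in).
Definition eltM (h k : elt) : elt := exist _ (val h * val k) (asboolT (eltM_in h k)).
Definition eltV (h : elt) : elt := exist _ (val h)^-1 (asboolT (eltV_in h)).

Definition smul (h : elt) (n : adicN a) : adicN a :=
  AdicN (subgroup_mul_in_N n (elt_in h)).

Lemma elt_neq0 (h : elt) : val h != 0.
Proof.
by case: HS => -[H0 _ _ _] _ _; exact/lt0r_neq0/H0/elt_in.
Qed.

Definition semidirect := (adicN a * elt)%type.
HB.instance Definition _ := Choice.on semidirect.

Definition sd_one : semidirect := (0, elt1).
Definition sd_mul (s t : semidirect) : semidirect :=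
  (s.1 + smul s.2 t.1, eltM s.2 t.2).
Definition sd_inv (s : semidirect) : semidirect :=
  (- smul (eltV s.2) s.1, eltV s.2).

Lemma sd_mulA : associative sd_mul.
Proof.
move=> [n h] [m k] [l j]; congr (_, _); apply: val_inj => /=.
  by rewrite /= mulrDr mulrA addrA.
by rewrite mulrA.
Qed.

Lemma sd_mul1 : left_id sd_one sd_mul.
Proof.
by move=> [n h]; congr (_, _); apply: val_inj; rewrite /= mul1r ?add0r.
Qed.

Lemma sd_mulr1 : right_id sd_one sd_mul.
Proof.
by move=> [n h]; congr (_, _); apply: val_inj; rewrite /= ?mulr1 // mulr0 addr0.
Qed.

Lemma sd_mulV : left_inverse sd_one sd_inv sd_mul.
Proof.
move=> [n h]; congr (_, _); apply: val_inj => /=; first by rewrite addNr.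
by rewrite mulVf // elt_neq0.
Qed.

Lemma sd_mulrV : right_inverse sd_one sd_inv sd_mul.
Proof.
move=> [n h]; congr (_, _); apply: val_inj => /=.
  by rewrite mulrN mulrA mulfV ?elt_neq0 // mul1r subrr.
by rewrite mulfV // elt_neq0.
Qed.

HB.instance Definition _ := isGroup.Build semidirect
  sd_mulA sd_mul1 sd_mulr1 sd_mulV sd_mulrV.

End Multiplication.

Definition CC (R : realType) : numClosedFieldType := complex.complex R.

Record cstar_algebra (R : realType) := CstarAlgebra {
  cs_sort :> completeNormedModType (CC R);
  cs_mul : cs_sort -> cs_sort -> cs_sort;
  cs_star : cs_sort -> cs_sort;
  cs_mulA : associative cs_mul;
  cs_mulPl : forall y, linear (cs_mul ^~ y);
  cs_mulPr : forall x, linear (cs_mul x);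
  cs_norm_mul : forall x y, `|cs_mul x y| <= `|x| * `|y|;
  cs_starK : involutive cs_star;
  cs_starP : forall (c : CC R) x y,
    cs_star (c *: x + y) = c^* *: cs_star x + cs_star y;
  cs_starM : forall x y, cs_star (cs_mul x y) = cs_mul (cs_star y) (cs_star x);
  cs_norm_star : forall x, `|cs_mul (cs_star x) x| = `|x| ^+ 2 }.

Definition cstar_iso (R : realType) (A B : cstar_algebra R) : Prop :=
  exists phi : A -> B,
    [/\ bijective phi, linear phi,
        (forall x y, phi (cs_mul x y) = cs_mul (phi x) (phi y)) &
        (forall x, phi (cs_star x) = cs_star (phi x))].

Record hilbert_space (R : realType) := HilbertSpace {
  hs_sort :> completeNormedModType (CC R);
  hs_dot : hs_sort -> hs_sort -> CC R;
  hs_dotP : forall y (c : CC R) x x',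
    hs_dot (c *: x + x') y = c * hs_dot x y + hs_dot x' y;
  hs_dotC : forall x y, hs_dot y x = (hs_dot x y)^*;
  hs_dot_norm : forall x, hs_dot x x = `|x| ^+ 2 }.

Definition op_norm (R : realType) (E : hilbert_space R) (T : E -> E) : R :=
  sup [set complex.Re `|T xi| | xi in [set xi : E | `|xi| <= 1]].

Definition C0 (R : realType) (X : topologicalType) : set (X -> CC R) :=
  [set f | continuous f /\
    forall e : CC R, 0 < e -> compact [set x | e <= `|f x|]].
Arguments C0 : clear implicits.

Section CrossedProduct.
Variables (R : realType) (X : topologicalType) (G : groupType).
(* [alpha] is meant to be an action of the discrete group [G] on C_0(X); its
   values outside C_0(X) are irrelevant. *)
Variable alpha : G -> (X -> CC R) -> (X -> CC R).

(* [cov_pi] need not be nondegenerate: degenerate representations do not change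
   the supremum defining [universal_norm]. *)
Record covariant_rep (E : hilbert_space R) := CovariantRep {
  cov_pi : (X -> CC R) -> E -> E;
  cov_U : G -> E -> E;
  cov_pi_bounded : forall f, C0 R X f -> linear (cov_pi f) /\ continuous (cov_pi f);
  cov_pi_lin : forall (c : CC R) f g xi, C0 R X f -> C0 R X g ->
    cov_pi (fun x => c * f x + g x) xi = c *: cov_pi f xi + cov_pi g xi;
  cov_pi_mul : forall f g xi, C0 R X f -> C0 R X g ->
    cov_pi (fun x => f x * g x) xi = cov_pi f (cov_pi g xi);
  cov_pi_star : forall f xi eta, C0 R X f ->
    hs_dot (cov_pi f xi) eta = hs_dot xi (cov_pi (fun x => (f x)^*) eta);
  cov_U_lin : forall s, linear (cov_U s);
  cov_U_isometric : forall s xi eta,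
    hs_dot (cov_U s xi) (cov_U s eta) = hs_dot xi eta;
  cov_U1 : forall xi, cov_U 1%g xi = xi;
  cov_UM : forall s t xi, cov_U (s * t)%g xi = cov_U s (cov_U t xi);
  cov_covariant : forall s f xi, C0 R X f ->
    cov_pi (alpha s f) xi = cov_U s (cov_pi f (cov_U s^-1%g xi)) }.

(* C_c(G, C_0(X)); the modular function of the discrete group [G] is trivial,
   hence does not occur in [cc_star]. *)
Definition cc_alg : set (G -> X -> CC R) :=
  [set F | finite_set [set s | F s != cst 0] /\ forall s, C0 R X (F s)].
Definition cc_mul (F F' : G -> X -> CC R) : G -> X -> CC R :=
  fun s x => \sum_(t \in [set: G]) F t x * alpha t (F' (t^-1 * s)%g) x.
Definition cc_star (F : G -> X -> CC R) : G -> X -> CC R :=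
  fun s => alpha s (fun x => (F s^-1%g x)^*).

Definition integrated (E : hilbert_space R) (r : covariant_rep E)
    (F : G -> X -> CC R) (xi : E) : E :=
  \sum_(s \in [set: G]) cov_pi r (F s) (cov_U r s xi).

Definition universal_norm (F : G -> X -> CC R) : R :=
  sup [set nu : R | exists (E : hilbert_space R) (r : covariant_rep E),
                      nu = op_norm (integrated r F)].

(* The full crossed product of C_0(X) by G, as the completion of C_c(G, C_0(X))
   in the universal norm; an inhabitant is such a completion, and any two are
   canonically isomorphic. *)
Record crossed_product := CrossedProduct {
  cp_sort :> cstar_algebra R;
  cp_in : (G -> X -> CC R) -> cp_sort;
  cp_in_lin : forall (c : CC R) F F', cc_alg F -> cc_alg F' ->
    cp_in (fun s x => c * F s x + F' s x) = c *: cp_in F + cp_in F';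
  cp_in_mul : forall F F', cc_alg F -> cc_alg F' ->
    cp_in (cc_mul F F') = cs_mul (cp_in F) (cp_in F');
  cp_in_star : forall F, cc_alg F -> cp_in (cc_star F) = cs_star (cp_in F);
  cp_in_norm : forall F, cc_alg F ->
    `|cp_in F| = complex.Complex (universal_norm F) 0 :> CC R;
  cp_dense : dense (cp_in @` cc_alg) }.

End CrossedProduct.

Section Qbar.
Variables (R : realType) (a : adic_seq) (H : set rat).
Variables (HS : nontrivial_subgroup_of (adicS a) H) (Oa : Omega a).

(* The continuous extension to Omega_a of the multiplication by [h] on N_a; it
   is unique since N_a is dense and Omega_a is Hausdorff, so [xget] makes no
   arbitrary choice and the default [id] is never used. *)
Definition omega_mul (h : subgroup_elt HS) : Oa -> Oa :=
  @xget {classic Oa -> Oa} id [set g : Oa -> Oa |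
    continuous g /\ forall n : adicN a, g (hc_in Oa n) = hc_in Oa (smul h n)].

Definition alpha_aff (s : semidirect HS) (f : Oa -> CC R) : Oa -> CC R :=
  fun x => f (omega_mul (eltV s.2) (x - hc_in Oa s.1)).

Definition Qbar := crossed_product alpha_aff.

End Qbar.
Arguments Qbar R {a H} HS Oa.

(* Main.v *)
Require Import Defs.
From mathcomp Require Import all_boot all_order all_algebra.
From mathcomp Require Import finmap ring.
From mathcomp Require Import all_classical all_reals all_analysis.
From mathcomp Require Import complex.

(* If [f : Omega_a -> Omega_b] is an isomorphism, then some compact open
   subgroup [W] of the closure of [Z] in [Omega_a] is mapped into the closure of
   [Z] in [Omega_b]; it meets [N_a] in [m Z], and [f W] meets [N_b] in [n Z].
   Since [N_a / m Z = Omega_a / W] and [N_b / n Z = Omega_b / f W] are isomorphic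
   subgroups of [Q / Z] up to scaling, and [W] and [f W] have the same finite
   cyclic quotients by open subgroups, multiplication by [n / m] maps [N_a] onto
   [N_b] and is a homeomorphism. It commutes with the multiplications by [H], and
   its extension [Omega_a -> Omega_b] is therefore equivariant for an isomorphism
   of the semidirect products, although [f] itself need not be. *)

Set Implicit Arguments.
Unset Strict Implicit.
Unset Printing Implicit Defensive.

Import Order.TTheory GRing.Theory Num.Theory.
Import numFieldNormedType.Exports.

Local Open Scope classical_set_scope.
Local Open Scope ring_scope.

(** * Topological groups and Hausdorff completions *)

(** The obstacle is that [f] need not carry [N_a] onto [N_b]: when every [a_i] is the same prime
    [p], multiplication by an irrational [p]-adic unit is an automorphism of Omega_a = Q_p that does
    not preserve N_a = Z[1/p], and translations by N_a are part of the action. So [f] only serves to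
    compare finite quotients. This succeeds because Q/Z has exactly one cyclic subgroup of each
    order [t], generated by the class of [1/t]: isomorphic subgroups of Q/Z are equal, whatever the
    isomorphism. On the analytic side the crossed products are arbitrary completions, so their
    isomorphism is built as the closure of a norm-preserving correspondence between two copies of
    the convolution algebra. *)

Lemma nbhs0_sub (M : topologicalZmodType) (W : set M) : nbhs 0 W ->
  exists2 U : set M, nbhs 0 U & forall u v, U u -> U v -> W (u - v).
Proof.
move=> W0; have := @sub_continuous M (0, 0) W; rewrite /= subr0 => /(_ W0).
move=> [[U V] [/= U0 V0] UV]; exists (U `&` V); first exact: filterI.
by move=> u v [Uu _] [_ Vv]; exact: (UV (u, v)).
Qed.

Lemma addl_continuous (M : topologicalZmodType) (x : M) : continuous (fun u => x + u).
Proof.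
move=> u; apply: (@continuous_comp _ _ _ (fun u => (x, u)) (fun z : M * M => z.1 + z.2)).
  by apply: cvg_pair; [exact: cvg_cst|exact: cvg_id].
exact: add_continuous.
Qed.

Lemma subr_continuous (M : topologicalZmodType) (x : M) : continuous (fun u => u - x).
Proof.
move=> u; have -> : (fun u => u - x) = (fun u => - x + u).
  by apply/funext => v; rewrite addrC.
exact: addl_continuous.
Qed.

Lemma nbhs_addl (M : topologicalZmodType) (x : M) (A : set M) :
  nbhs x A -> nbhs 0 [set u | A (x + u)].
Proof. by move=> xA; apply: addl_continuous; rewrite addr0. Qed.

Lemma nbhs_subr (M : topologicalZmodType) (x : M) (W : set M) :
  nbhs 0 W -> nbhs x [set z | W (z - x)].
Proof. by move=> W0; apply: subr_continuous; rewrite subrr. Qed.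

Lemma dense_nbhs (T : topologicalType) (D : set T) (x : T) (A : set T) :
  dense D -> nbhs x A -> exists2 d, D d & A d.
Proof.
move=> dD; rewrite nbhsE => -[V [oV Vx] VA].
have [|d [Vd Dd]] := dD V _ oV.
  by exists x.
by exists d => //; exact: VA.
Qed.

Lemma continuous_dense_eq (T U : topologicalType) (D : set T) (f g : T -> U) :
  hausdorff_space U -> dense D -> continuous f -> continuous g ->
  (forall x, D x -> f x = g x) -> f = g.
Proof.
move=> hU dD cf cg fg; apply/funext => x; apply: hU => A B fA gB.
have fgAB : nbhs x ((f @^-1` A) `&` (g @^-1` B)) by apply: filterI; [exact: cf|exact: cg].
have [d Dd [Ad Bd]] := dense_nbhs dD fgAB.
by exists (f d); split => //=; rewrite fg.
Qed.

Section CompletionExtension.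
Variables (M M' : zmodType) (B : set_system M) (B' : set_system M').
Variables (O : hausdorff_completion B) (O' : hausdorff_completion B').
Variable phi : M -> M'.
Hypothesis phiB : {morph phi : x y / x - y}.
Hypothesis phi_cont : forall V, B' V -> exists2 W, B W & W `<=` phi @^-1` V.

Let th := hc_in O.
Let th' n := hc_in O' (phi n).

(** Uniform continuity of [phi], read in the completions: by [hc_initial], closeness in [O] of two
    points of [M] controls closeness in [M], which [phi_cont] and [hc_continuous] carry over to
    [O']. *)
Let small (W : set O') : nbhs 0 W ->
  exists2 U : set O, nbhs 0 U & forall m n, U (th m - th n) -> W (th' m - th' n).
Proof.
move=> /hc_continuous[V BV VW]; have [V1 BV1 V1V] := phi_cont BV.
have [U U0 UV1] := hc_initial O BV1; exists U => // m n.
by rewrite /th /th' -!raddfB /= -phiB => Umn; apply/VW/V1V/UV1.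
Qed.

Let small_nbhs (W : set O') (x : O) : nbhs 0 W ->
  exists2 A : set O, nbhs x A &
    forall m n, A (th m) -> A (th n) -> W (th' m - th' n).
Proof.
move=> /small[U U0 UW]; have [U1 U10 U1U] := nbhs0_sub U0.
exists [set z | U1 (z - x)]; first exact: nbhs_subr.
move=> m n Am An; apply: UW.
have -> : th m - th n = (th m - x) - (th n - x) by rewrite opprB addrA subrK.
exact: U1U.
Qed.

(** The images of the points of [M] close to [x]. By [small_nbhs] this filter is Cauchy, and its
    limit is the only possible value at [x] of a continuous extension. *)
Let img_filter (x : O) : set_system O' :=
  [set A | exists2 U, nbhs x U & forall n, U (th n) -> A (th' n)].

Let img_filter_proper x : ProperFilter (img_filter x).
Proof.
apply: Build_ProperFilter_ex.
  move=> A [U xU UA]; have [_ [n _ <-] Un] := dense_nbhs (@hc_dense _ _ O) xU.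
  by exists (th' n); exact: UA.
split.
- by exists setT => //; exact: filterT.
- move=> A A' [U xU UA] [V xV VA]; exists (U `&` V); first exact: filterI.
  by move=> n [Un Vn]; split; [exact: UA|exact: VA].
- by move=> A A' AA' [U xU UA]; exists U => // n /UA/AA'.
Qed.

Let img_filter_cvg x : exists y : O', img_filter x --> y.
Proof.
apply: (@hc_complete _ _ O'); first exact: img_filter_proper.
move=> W /(small_nbhs x)[A xA AW].
exists [set th' n | n in [set n | A (th n)]]; first by exists A => // n An; exists n.
by move=> _ _ [m Am <-] [n An <-]; exact: AW.
Qed.

Lemma completion_extension :
  exists2 G : O -> O', continuous G & forall n, G (hc_in O n) = hc_in O' (phi n).
Proof.
have [G Gcvg] := choice img_filter_cvg; exists G; last first.
  move=> n; apply: (@hc_hausdorff _ _ O') => C D nC nD.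
  have [U xU UC] := Gcvg _ _ nC.
  exists (hc_in O' (phi n)); split; last exact: nbhs_singleton.
  by apply: UC; exact: nbhs_singleton.
move=> x N /nbhs_addl N0; have [W1 W10 W1N] := nbhs0_sub N0.
have [U xU UW] := Gcvg x _ (nbhs_subr (G x) W10).
move: xU; rewrite nbhs_simpl /= nbhsE => -[V [oV Vx] VU].
exists V => // z Vz /=.
have [U' zU' U'W] := Gcvg z _ (nbhs_subr (G z) W10).
have zV : nbhs z V by exact: open_nbhs_nbhs.
(* A single [n] links the two values: [th' n] is close to [G x] because [V] lies in [U], and close
   to [G z] by the choice of [U']. *)
have [_ [n _ <-] [U'n Vn]] := dense_nbhs (@hc_dense _ _ O) (filterI zU' zV).
have := W1N _ _ (UW n (VU _ Vn)) (U'W n U'n) => /=.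
by rewrite opprB [_ + (G z - _)]addrC subrKA addrC subrK.
Qed.

End CompletionExtension.

(** * Open subgroups of a completion and their traces *)

Definition open_subgroup (M : topologicalZmodType) (W : set M) : Prop :=
  nbhs 0 W /\ forall x y, W x -> W y -> W (x - y).

Section OpenSubgroup.
Variables (M : topologicalZmodType) (W : set M).
Hypothesis oW : open_subgroup W.

Lemma open_subgroup0 : W 0.
Proof. exact: nbhs_singleton oW.1. Qed.

Lemma open_subgroupN x : W x -> W (- x).
Proof. by move=> Wx; rewrite -sub0r; apply: oW.2 => //; exact: open_subgroup0. Qed.

Lemma open_subgroupD x y : W x -> W y -> W (x + y).
Proof. by move=> Wx Wy; rewrite -[y]opprK; apply: oW.2 => //; exact: open_subgroupN. Qed.

Lemma open_subgroupMz x (z : int) : W x -> W (x *~ z).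
Proof.
move=> Wx; have Wn n : W (x *+ n).
  elim: n => [|n IH]; first by rewrite mulr0n; exact: open_subgroup0.
  by rewrite mulrS; exact: open_subgroupD.
by case: z => n; [exact: Wn|rewrite NegzE mulrNz; exact: open_subgroupN (Wn _)].
Qed.

Lemma open_subgroup_subr x y : W (x - y) -> W y <-> W x.
Proof.
move=> Wxy; split=> [Wy|Wx]; first by rewrite -(subrK y x); exact: open_subgroupD.
by rewrite -[y](subKr x); exact: oW.2.
Qed.

End OpenSubgroup.

Lemma open_subgroupI (M : topologicalZmodType) (W W' : set M) :
  open_subgroup W -> open_subgroup W' -> open_subgroup (W `&` W').
Proof.
move=> [W0 WB] [W'0 W'B]; split; first exact: filterI.
by move=> x y [Wx W'x] [Wy W'y]; split; [exact: WB|exact: W'B].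
Qed.

Lemma open_subgroup_preim (M M' : topologicalZmodType) (f : M -> M') (W : set M') :
  {morph f : x y / x - y} -> continuous f -> open_subgroup W ->
  open_subgroup (f @^-1` W).
Proof.
move=> fB cf [W0 WB]; have f0 : f 0 = 0 by rewrite -(subrr 0) fB subrr.
split; first by apply: (cf 0); rewrite f0.
by move=> x y Wx Wy; rewrite /preimage /= fB; exact: WB.
Qed.

Section CompletionSubgroup.
Variables (M : zmodType) (B : set_system M) (O : hausdorff_completion B).

Lemma completion_approx (W : set O) x : open_subgroup W ->
  exists n, W (hc_in O n - x).
Proof.
move=> [W0 _]; have [_ [n _ <-] Wn] := dense_nbhs (@hc_dense _ _ O) (nbhs_subr x W0).
by exists n.
Qed.

(** The closure of the image of [V] works: it is a neighbourhood of 0 since [M] is dense and small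
    elements of [M] lie in [V], and its trace is no larger than [V] because a subgroup open in [M]
    is closed. *)
Lemma completion_open_subgroup (V : set M) : B V ->
  (forall x y, V x -> V y -> V (x - y)) ->
  exists2 W : set O, open_subgroup W & forall n, W (hc_in O n) <-> V n.
Proof.
move=> BV VB; have [U U0 UV] := hc_initial O BV.
exists (closure [set hc_in O n | n in V]); last first.
  move=> n; split=> [|Vn]; last by apply: subset_closure; exists n.
  move=> /(_ _ (nbhs_subr (hc_in O n) U0))[_ [[v Vv <-]]] /=.
  rewrite -raddfB => /UV Vvn; have := VB _ _ Vv Vvn.
  by rewrite opprB addrC subrK.
split.
  move: U0; rewrite nbhsE => -[U1 [oU1 U10] U1U].
  exists U1 => [|u U1u C uC]; first by [].
  have uCU : nbhs u (C `&` U1).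
    by apply: filterI => //; exact: open_nbhs_nbhs.
  have [_ [n _ <-] [Cn U1n]] := dense_nbhs (@hc_dense _ _ O) uCU.
  by exists (hc_in O n); split=> //; exists n => //; exact/UV/U1U.
move=> x y clx cly C xyC.
have [U1 U10 U1C] := nbhs0_sub (nbhs_addl xyC).
have [_ [[v Vv <-] /= Uv]] := clx _ (nbhs_subr x U10).
have [_ [[w Vw <-] /= Uw]] := cly _ (nbhs_subr y U10).
exists (hc_in O (v - w)); split; first by exists (v - w) => //; exact: VB.
rewrite (_ : hc_in O (v - w) = (x - y) + ((hc_in O v - x) - (hc_in O w - y))).
  exact: (U1C _ _ Uv Uw).
by rewrite raddfB (opprB (hc_in O w) y) [RHS]addrACA addKr [x + _]addrC subrK.
Qed.

End CompletionSubgroup.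

(** * C*-algebras and crossed products *)

Section CstarTheory.
Variables (R : realType) (A : cstar_algebra R).
Implicit Types x y : A.

Lemma cs_starB x y : cs_star (x - y) = cs_star x - cs_star y.
Proof.
by rewrite addrC -(scaleN1r y) cs_starP rmorphN rmorph1 scaleN1r addrC.
Qed.

Lemma cs_mulBl x y z : cs_mul (x - y) z = cs_mul x z - cs_mul y z.
Proof. by rewrite addrC -(scaleN1r y) (@cs_mulPl _ A z) scaleN1r addrC. Qed.

Lemma cs_mulBr x y z : cs_mul z (x - y) = cs_mul z x - cs_mul z y.
Proof. by rewrite addrC -(scaleN1r y) (@cs_mulPr _ A z) scaleN1r addrC. Qed.

Lemma cs_star_norm_le x : `|x| <= `|cs_star x|.
Proof.
have [->|x0] := eqVneq x 0; first by rewrite normr0.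
rewrite -(ler_pM2r (_ : 0 < `|x|)) ?normr_gt0 // -expr2 -cs_norm_star.
exact: cs_norm_mul.
Qed.

Lemma norm_cs_star x : `|cs_star x| = `|x|.
Proof.
by apply: le_anti; rewrite cs_star_norm_le -{2}(cs_starK x) cs_star_norm_le.
Qed.

End CstarTheory.

Lemma dense_norm (R : realType) (A : cstar_algebra R) (T : Type) (D : set T)
    (i : T -> A) : dense (i @` D) ->
  forall x (e : CC R), 0 < e -> exists2 F, D F & `|x - i F| < e.
Proof.
move=> di x e e0; have [_ [F DF <-] xF] := dense_nbhs di (nbhsx_ballx x e e0).
by exists F => //; move: xF; rewrite -ball_normE.
Qed.

(** * Isomorphism of completions of a common star-algebra *)

Section Closeness.
Variables (R : realType) (T : Type) (D : set T).
Variables (linT : CC R -> T -> T -> T) (mulT : T -> T -> T) (starT : T -> T).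
Hypothesis D_lin : forall c F F', D F -> D F' -> D (linT c F F').
Hypothesis D_mul : forall F F', D F -> D F' -> D (mulT F F').
Hypothesis D_star : forall F, D F -> D (starT F).

(** [cp_in] is controlled only on [cc_alg], a set of plain functions, so the common dense subalgebra
    is modelled by a set [D] with three operations. *)
Record star_hom (A : cstar_algebra R) (i : T -> A) : Prop := StarHom {
  sh_lin : forall c F F', D F -> D F' -> i (linT c F F') = c *: i F + i F';
  sh_mul : forall F F', D F -> D F' -> i (mulT F F') = cs_mul (i F) (i F');
  sh_star : forall F, D F -> i (starT F) = cs_star (i F);
  sh_dense : dense (i @` D) }.

(* The closure of [{(i F, j F) | F in D}], which is the graph of the isomorphism
   extending [i F |-> j F]. *)
Definition closely (A B : cstar_algebra R) (i : T -> A) (j : T -> B) x y :=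
  forall e : CC R, 0 < e -> exists F, [/\ D F, `|x - i F| < e & `|y - j F| < e].

Lemma closely_sym A B i j x y : @closely A B i j x y -> closely j i y x.
Proof. by move=> xy e /xy[F [DF ? ?]]; exists F. Qed.

Section Pair.
Variables (A B : cstar_algebra R) (i : T -> A) (j : T -> B).
Hypotheses (ih : star_hom i) (jh : star_hom j).
Hypothesis ij_norm : forall F, D F -> `|i F| = `|j F|.

(** [i F - i F'] is the image of [linT (-1) F' F], so preservation of norms on [D] yields
    preservation of distances. *)
Lemma distij F F' : D F -> D F' -> `|i F - i F'| = `|j F - j F'|.
Proof.
move=> DF DF'; rewrite [i F - _]addrC [j F - _]addrC.
rewrite -(scaleN1r (i F')) -(scaleN1r (j F')) -(sh_lin ih) // -(sh_lin jh) //.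
exact/ij_norm/D_lin.
Qed.

Lemma closely_inj x x' y : closely i j x y -> closely i j x' y -> x = x'.
Proof.
move=> xy x'y.
(* The chain runs through [x], [i F], [i F'], [x']; the middle distance equals that of [j F] and
   [j F'], which is at most [e + e] since both are close to [y]. A quarter of the distance of [x]
   and [x'], taken for [e], then gives a contradiction. *)
have key e : 0 < e -> `|x - x'| < e + (e + (e + e)).
  move=> e0; have [F [DF xF yF]] := xy _ e0; have [F' [DF' x'F' yF']] := x'y _ e0.
  apply: le_lt_trans (ler_distD (i F) _ _) _; apply: ltr_leD xF _.
  apply: le_trans (ler_distD (i F') _ _) _; rewrite addrC (distrC _ x').
  apply: lerD (ltW x'F') _; rewrite distij //.
  by apply: le_trans (ler_distD y _ _) _; rewrite distrC; apply: lerD; exact: ltW.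
apply/eqP; rewrite -subr_eq0 -normr_le0; apply/negPn/negP => xx'.
have {}xx' : 0 < `|x - x'|.
  by rewrite lt_def normr_ge0 andbT; apply: contra xx' => /eqP ->.
have := key (`|x - x'| / 2 / 2); rewrite addrA -!splitr ltxx => /implyP.
by rewrite !divr_gt0.
Qed.

(** The points [j F] with [i F] close to [x] generate a Cauchy filter because distances are
    preserved; completeness of [B] supplies [y]. *)
Lemma closely_total x : exists y, closely i j x y.
Proof.
pose Fx : set_system B := [set S | exists2 e : CC R, 0 < e &
  forall F, D F -> `|x - i F| < e -> S (j F)].
have Fxp : ProperFilter Fx.
  apply: Build_ProperFilter_ex.
    move=> S [e e0 eS]; have [F DF xF] := dense_norm (sh_dense ih) x e0.
    by exists (j F); exact: eS.
  split.
  - by exists 1.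
  (* The order on [CC R] is partial, so this quotient stands in for the minimum of [e] and [e']: it
     is below both. *)
  - move=> S S' [e e0 eS] [e' e'0 eS']; exists (e * e' / (e + e')).
      by rewrite divr_gt0 ?mulr_gt0 ?addr_gt0.
    move=> F DF xF; split; [apply: eS => //|apply: eS' => //];
      apply: lt_le_trans xF _; rewrite ler_pdivrMr ?addr_gt0 //.
      by rewrite mulrDr lerDr mulr_ge0 // ltW.
    by rewrite mulrDr [e * e']mulrC lerDl mulr_ge0 // ltW.
  - by move=> S S' SS' [e e0 eS]; exists e => // F DF /(eS _ DF)/SS'.
have Fxc : cauchy Fx.
  apply: cauchy_exP => e e0; have e20 : 0 < e / 2 by rewrite divr_gt0.
  have [F DF xF] := dense_norm (sh_dense ih) x e20.
  exists (j F), (e / 2) => //.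
  move=> F' DF' xF'; rewrite -ball_normE /= -distij // -(subrKA x).
  apply: le_lt_trans (ler_normD _ _) _; rewrite (splitr e) distrC.
  exact: ltrD.
have /cvg_ex[y Fy] := @cauchy_cvg _ Fx Fxp Fxc; exists y => e e0.
have [e' e'0 Fe'] := Fy _ (nbhsx_ballx y e e0).
have d0 : 0 < e * e' / (e + e') by rewrite divr_gt0 ?mulr_gt0 ?addr_gt0.
have [F DF xF] := dense_norm (sh_dense ih) x d0.
exists F; split => //.
  by apply: lt_le_trans xF _; rewrite ler_pdivrMr ?addr_gt0 // mulrDr lerDr mulr_ge0 // ltW.
have : ball y e (j F).
  apply: Fe' => //; apply: lt_le_trans xF _.
  by rewrite ler_pdivrMr ?addr_gt0 // mulrDr [e * e']mulrC lerDl mulr_ge0 // ltW.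
by rewrite -ball_normE.
Qed.

End Pair.

Lemma norm_lin_lt (A : cstar_algebra R) (c e : CC R) (x x' y y' : A) :
  `|x - y| < e / (`|c| + 1) -> `|x' - y'| < e / (`|c| + 1) ->
  `|(c *: x + x') - (c *: y + y')| < e.
Proof.
have c1 : 0 < `|c| + 1 by rewrite ltr_wpDl.
move=> xy xy'; rewrite opprD addrACA -scalerBr.
apply: le_lt_trans (ler_normD _ _) _; rewrite normrZ.
rewrite -[ltRHS](@divfK _ (`|c| + 1)) ?gt_eqF // mulrDr mulr1 [_ * `|c|]mulrC.
by apply: ler_ltD => //; apply: ler_wpM2l => //; exact: ltW.
Qed.

(** Split the difference as [x (x' - y') + (x - y) y']; since [d <= 1], the norm of [y'] is below
    that of [x'] plus 1. *)
Lemma norm_mul_lt (A : cstar_algebra R) (e d : CC R) (x x' y y' : A) :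
  0 < d -> d <= 1 -> d * (`|x| + `|x'| + 1) <= e ->
  `|x - y| < d -> `|x' - y'| < d -> `|cs_mul x x' - cs_mul y y'| < e.
Proof.
move=> d0 d1 de xy xy'; rewrite -(subrKA (cs_mul x y')) -cs_mulBr -cs_mulBl.
apply: lt_le_trans de; apply: le_lt_trans (ler_normD _ _) _.
have y'x' : `|y'| < `|x'| + 1.
  rewrite -[y'](subKr x'); apply: le_lt_trans (ler_normB _ _) _.
  by rewrite ltrD2l (lt_le_trans xy').
rewrite -addrA mulrDr; apply: ler_ltD.
  apply: le_trans (cs_norm_mul _ _) _; rewrite mulrC.
  by apply: ler_wpM2r => //; exact: ltW.
apply: le_lt_trans (cs_norm_mul _ _) _.
apply: le_lt_trans (ler_wpM2l _ (ltW y'x')) _ => //.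
by rewrite ltr_pM2r // ltr_wpDl.
Qed.

Lemma dense_star_hom_iso (A B : cstar_algebra R) (i : T -> A) (j : T -> B) :
  star_hom i -> star_hom j -> (forall F, D F -> `|i F| = `|j F|) ->
  cstar_iso A B.
Proof.
move=> ih jh ij.
have ji F : D F -> `|j F| = `|i F| by move=> /ij.
have [phi phiP] := choice (closely_total ih jh ij).
have [psi psiP] := choice (closely_total jh ih ji).
have phiE x y : closely i j x y -> phi x = y.
  move=> xy; apply: (closely_inj jh ih ji (closely_sym (phiP x))).
  exact: closely_sym.
exists phi; split.
- exists psi => [x|y].
    apply: (closely_inj ih jh ij _ (phiP x)); exact: closely_sym (psiP _).
  exact/phiE/closely_sym.
- move=> c x x'; apply: phiE => e e0.
  have d1 : 0 < e / (`|c| + 1) by rewrite !divr_gt0 // ltr_wpDl.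
  have [F [DF xF yF]] := phiP x _ d1; have [F' [DF' xF' yF']] := phiP x' _ d1.
  exists (linT c F F'); rewrite (sh_lin ih) // (sh_lin jh) //.
  by split; [exact: D_lin|exact: norm_lin_lt|exact: norm_lin_lt].
- move=> x x'; apply: phiE => e e0.
  pose s := `|x| + `|x'| + (`|phi x| + `|phi x'|) + 1.
  have s0 : 0 < s + e by rewrite addr_gt0 // /s ltr_wpDl // !addr_ge0.
  (* This gives [d <= 1] and [d * s <= e] at once. The norms in [A] and in [B] both enter [s], so
     that one [d] serves both estimates. *)
  pose d := e / (s + e).
  have d0 : 0 < d by rewrite divr_gt0.
  have d1 : d <= 1 by rewrite ler_pdivrMr // mul1r lerDr /s !addr_ge0.
  have ds : d * s <= e.
    by rewrite /d mulrAC ler_pdivrMr // ler_pM2l // lerDl ltW.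
  have [F [DF xF yF]] := phiP x _ d0; have [F' [DF' xF' yF']] := phiP x' _ d0.
  exists (mulT F F'); rewrite (sh_mul ih) // (sh_mul jh) //.
  split; first exact: D_mul.
    apply: (norm_mul_lt d0 d1 _ xF xF'); apply: le_trans ds.
    by rewrite ler_pM2l // /s lerD2r lerDl addr_ge0.
  apply: (norm_mul_lt d0 d1 _ yF yF'); apply: le_trans ds.
  by rewrite ler_pM2l // /s lerD2r lerDr addr_ge0.
- move=> x; apply: phiE => e e0; have [F [DF xF yF]] := phiP x _ e0.
  exists (starT F); rewrite (sh_star ih) // (sh_star jh) // -!cs_starB !norm_cs_star.
  by split=> //; exact: D_star.
Qed.

End Closeness.

(** * Functions vanishing at infinity *)

Section NumClosedContinuity.
Variables (K : numClosedFieldType) (X : topologicalType).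
Implicit Types (h : X -> K) (e : K).

(** The order of [K] is only partial; norms and positive elements are real, hence comparable. *)
Lemma ltNge_norm (V : normedZmodType K) (v : V) e :
  0 < e -> (`|v| < e) = ~~ (e <= `|v|).
Proof. by move=> e0; rewrite real_ltNge ?normr_real // gtr0_real. Qed.

Lemma closed_norm_ge h e : continuous h -> 0 < e -> closed [set x | e <= `|h x|].
Proof.
move=> ch e0.
have -> : [set x | e <= `|h x|] = ~` [set x | `|h x| < e].
  apply/seteqP; split=> x /=; rewrite ltNge_norm //; first by move=> ->.
  by move/negP; rewrite negbK.
apply: open_closedC; rewrite openE => x /= hx.
have d0 : 0 < e - `|h x| by rewrite subr_gt0.
have /cvgrPdist_lt/(_ _ d0) := ch x; apply: filterS => y hxy.
rewrite /= -[h y](subKr (h x)); apply: le_lt_trans (ler_normB _ _) _.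
by rewrite -ltrBrDl.
Qed.

Lemma continuous_conj h : continuous h -> continuous (fun x => (h x)^*).
Proof.
move=> ch x; apply/cvgrPdist_lt => e e0.
have /cvgrPdist_lt/(_ _ e0) := ch x; apply: filterS => y.
by rewrite -rmorphB norm_conjC.
Qed.

Lemma continuous_lin (c : K) h h' : continuous h -> continuous h' ->
  continuous (fun x => c * h x + h' x).
Proof.
move=> ch ch' x; apply: cvgD; last exact: ch'.
by apply: cvgM; [exact: cvg_cst|exact: ch].
Qed.

Lemma continuous_mul h h' : continuous h -> continuous h' ->
  continuous (fun x => h x * h' x).
Proof. by move=> ch ch' x; apply: cvgM; [exact: ch|exact: ch']. Qed.

End NumClosedContinuity.

Section VanishingAtInfinity.
Variables (R : realType) (X : topologicalType).
Implicit Types (f g h : X -> CC R) (e d : CC R).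

(** Where [h] has norm at least [e], one of [f], [g] has norm at least [d]: the set in question is
    closed in a union of two compact sets. *)
Lemma C0_control f g h : C0 R X f -> C0 R X g -> continuous h ->
  (forall e, 0 < e -> exists2 d, 0 < d &
     forall x, `|f x| < d -> `|g x| < d -> `|h x| < e) ->
  C0 R X h.
Proof.
move=> [cf Kf] [cg Kg] ch fgh; split=> // e e0; have [d d0 fgd] := fgh e e0.
apply: subclosed_compact (compactU (Kf d d0) (Kg d d0)) _.
  exact: closed_norm_ge.
move=> x /= hx; apply: contrapT => /not_orP[/negP fx /negP gx].
by move: hx; apply/negP; rewrite -ltNge_norm //; apply: fgd; rewrite ltNge_norm.
Qed.

Lemma C0_cst0 : C0 R X (cst 0).
Proof.
split=> [|e e0]; first exact: cst_continuous.
rewrite [X in compact X](_ : _ = set0); first exact: compact0.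
by apply/seteqP; split=> x //=; rewrite normr0 => /(lt_le_trans e0); rewrite ltxx.
Qed.

Lemma C0_lin (c : CC R) f g : C0 R X f -> C0 R X g -> C0 R X (fun x => c * f x + g x).
Proof.
move=> f0 g0; apply: (C0_control f0 g0).
  exact: continuous_lin f0.1 g0.1.
move=> e e0; have c1 : 0 < `|c| + 1 by rewrite ltr_wpDl.
exists (e / (`|c| + 1)); first by rewrite divr_gt0.
move=> x fx gx; apply: le_lt_trans (ler_normD _ _) _.
rewrite normrM -[ltRHS](@divfK _ (`|c| + 1)) ?gt_eqF // mulrDr mulr1 [_ * `|c|]mulrC.
by apply: ler_ltD => //; apply: ler_wpM2l => //; exact: ltW.
Qed.

Lemma C0_mul f g : C0 R X f -> C0 R X g -> C0 R X (fun x => f x * g x).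
Proof.
move=> f0 g0; apply: (C0_control f0 g0).
  exact: continuous_mul f0.1 g0.1.
move=> e e0; have e1 : 0 < 1 + e by rewrite addr_gt0.
(* This number is at most 1 and at most [e], so the product of two smaller norms is below [e]. *)
exists (e / (1 + e)); first by rewrite divr_gt0.
move=> x fx gx; rewrite normrM; apply: le_lt_trans (ler_wpM2l _ (ltW gx)) _ => //.
apply: lt_le_trans (_ : (e / (1 + e)) * (e / (1 + e)) <= _).
  by rewrite ltr_pM2r // divr_gt0.
have le1 : e / (1 + e) <= 1 by rewrite ler_pdivrMr // mul1r lerDr.
apply: le_trans (_ : e / (1 + e) <= _); first by rewrite ger_pMr // divr_gt0.
by rewrite ler_pdivrMr // mulrDr mulr1 lerDl mulr_ge0 // ltW.
Qed.

Lemma C0_conj f : C0 R X f -> C0 R X (fun x => (f x)^*).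
Proof.
move=> f0; apply: (C0_control f0 f0).
  exact: continuous_conj f0.1.
by move=> e e0; exists e => // x; rewrite norm_conjC.
Qed.

Lemma C0_sum (I : eqType) (r : seq I) (F : I -> X -> CC R) :
  (forall i, C0 R X (F i)) -> C0 R X (fun x => \sum_(i <- r) F i x).
Proof.
move=> F0; elim: r => [|i r IH].
  rewrite [X in C0 _ _ X](_ : _ = cst 0); first exact: C0_cst0.
  by apply/funext => x; rewrite big_nil.
rewrite [X in C0 _ _ X](_ : _ = fun x => 1 * F i x + \sum_(j <- r) F j x).
  exact: C0_lin.
by apply/funext => x; rewrite big_cons mul1r.
Qed.

End VanishingAtInfinity.

Lemma C0_comp (R : realType) (X X' : topologicalType) (P : X -> X') (Q : X' -> X) f :
  cancel P Q -> cancel Q P -> continuous P -> continuous Q ->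
  C0 R X f -> C0 R X' (f \o Q).
Proof.
move=> PQ QP cP cQ [cf Kf]; split=> [x|e e0].
  by apply: continuous_comp; [exact: cQ|exact: cf].
rewrite [X in compact X](_ : _ = P @` [set x | e <= `|f x|]).
  apply: continuous_compact (Kf e e0); exact: continuous_subspaceT.
apply/seteqP; split=> [x /= fx|_ [x /= fx <-] /=]; last by rewrite PQ.
by exists (Q x).
Qed.

(** * The convolution algebra *)

Section CcAlgebra.
Variables (R : realType) (X : topologicalType) (G : groupType).
Variable alpha : G -> (X -> CC R) -> (X -> CC R).
Hypothesis alpha_C0 : forall t f, C0 R X f -> C0 R X (alpha t f).
Hypothesis alpha0 : forall t, alpha t (cst 0) = cst 0.
Implicit Types F : G -> X -> CC R.

Definition cc_lin (c : CC R) F F' : G -> X -> CC R := fun s x => c * F s x + F' s x.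

Lemma cc_alg_lin c F F' : cc_alg F -> cc_alg F' -> cc_alg (cc_lin c F F').
Proof.
move=> [fF F0] [fF' F'0]; split=> [|s]; last exact: C0_lin.
apply: (@sub_finite_set _ _ ([set s | F s != cst 0] `|` [set s | F' s != cst 0])).
  move=> s /= nz; apply: contrapT => /not_orP[/negP/negPn/eqP Fs /negP/negPn/eqP F's].
  move/eqP: nz; apply; apply/funext => x.
  by rewrite /cc_lin Fs F's /= mulr0 addr0.
by rewrite finite_setU.
Qed.

Lemma cc_alg_star F : cc_alg F -> cc_alg (cc_star alpha F).
Proof.
move=> [fF F0]; split=> [|s]; last exact/alpha_C0/C0_conj.
apply: (@sub_finite_set _ _ ((fun s : G => (s^-1)%g) @` [set s | F s != cst 0])).
  move=> s /= nz; exists (s^-1)%g; last by rewrite invgK.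
  apply: contra nz => /eqP Fs; rewrite /cc_star Fs.
  rewrite [X in alpha s X](_ : _ = cst 0) ?alpha0 //.
  by apply/funext => x /=; rewrite conjC0.
exact: finite_image.
Qed.

Lemma cc_alg_mul F F' : cc_alg F -> cc_alg F' -> cc_alg (cc_mul alpha F F').
Proof.
move=> [fF F0] [fF' F'0].
(* The sum over [G] reduces to the finite support of [F], the same for all [s] and [x]. *)
have mulE s x : cc_mul alpha F F' s x =
    \sum_(t <- fset_set [set t | F t != cst 0]) F t x * alpha t (F' (t^-1 * s)%g) x.
  rewrite -fsbig_finite //; apply/esym/fsbig_widen => // t [_ /= /negP/negPn/eqP ->].
  by rewrite mul0r.
split=> [|s]; last first.
  rewrite [X in C0 _ _ X](funext (mulE s)); apply: C0_sum => t.
  by apply: C0_mul => //; exact: alpha_C0.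
apply: (@sub_finite_set _ _ [set (t * u)%g | t in [set t | F t != cst 0] &
    u in [set u | F' u != cst 0]]); last exact: finite_image2.
move=> s /= nz; apply: contrapT => no; move/eqP: nz; apply; apply/funext => x.
rewrite mulE big_seq big1 // => t; rewrite in_fset_set // inE /= => Ft.
have [->|nz'] := eqVneq (F' (t^-1 * s)%g) (cst 0); first by rewrite alpha0 mulr0.
by case: no; exists t => //; exists (t^-1 * s)%g => //; rewrite mulgA mulgV mul1g.
Qed.

End CcAlgebra.

(** * Transport of crossed products along an isomorphism of actions *)

Record action_iso (R : realType) (X X' : topologicalType) (G G' : groupType)
    (alpha : G -> (X -> CC R) -> (X -> CC R))
    (alpha' : G' -> (X' -> CC R) -> (X' -> CC R))
    (P : X -> X') (Q : X' -> X) (s : G -> G') (r : G' -> G) : Prop := ActionIso {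
  ai_PQ : cancel P Q;
  ai_QP : cancel Q P;
  ai_P : continuous P;
  ai_Q : continuous Q;
  ai_sr : cancel s r;
  ai_rs : cancel r s;
  ai_sM : {morph s : x y / (x * y)%g};
  ai_alpha : forall t f x, alpha' (s t) f (P x) = alpha t (f \o P) x }.

Section ActionIso.
Variables (R : realType) (X X' : topologicalType) (G G' : groupType).
Variables (alpha : G -> (X -> CC R) -> (X -> CC R)).
Variables (alpha' : G' -> (X' -> CC R) -> (X' -> CC R)).
Variables (P : X -> X') (Q : X' -> X) (s : G -> G') (r : G' -> G).
Hypothesis ai : action_iso alpha alpha' P Q s r.

Lemma ai_s1 : s 1%g = 1%g.
Proof. by apply: (mulgI (s 1%g)); rewrite -(ai_sM ai) !mulg1. Qed.

Lemma ai_sV t : s (t^-1)%g = ((s t)^-1)%g.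
Proof. by apply: (mulgI (s t)); rewrite -(ai_sM ai) !mulgV ai_s1. Qed.

Lemma action_iso_sym : action_iso alpha' alpha Q P r s.
Proof.
case: ai => PQ QP cP cQ sr rs sM al; split=> //.
  by move=> x y; apply: (can_inj sr); rewrite sM !rs.
move=> t f x; rewrite -{2}(QP x) -{2}(rs t) al; congr (alpha _ _ _).
by apply/funext => y; rewrite /= PQ.
Qed.

Definition cc_transport (F : G -> X -> CC R) : G' -> X' -> CC R :=
  fun t x => F (r t) (Q x).

Section Representation.
Variables (E : hilbert_space R) (c : covariant_rep alpha' E).

Let piT (f : X -> CC R) := cov_pi c (f \o Q).
Let UT (t : G) := cov_U c (s t).
Let C0Q f : C0 R X f -> C0 R X' (f \o Q).
Proof. by apply: C0_comp (ai_PQ ai) (ai_QP ai) (ai_P ai) (ai_Q ai). Qed.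

(** The Hilbert space is kept; only the functions and the group elements are moved. The definition
    is transparent because [integrated_transport] unfolds it. *)
Definition cov_transport : covariant_rep alpha E.
Proof.
apply: (@CovariantRep _ _ _ _ _ piT UT).
- by move=> f f0; apply: cov_pi_bounded; exact: C0Q.
- by move=> a f g xi f0 g0; apply: cov_pi_lin; exact: C0Q.
- by move=> f g xi f0 g0; apply: cov_pi_mul; exact: C0Q.
- by move=> f xi eta f0; apply: cov_pi_star; exact: C0Q.
- by move=> t; exact: cov_U_lin.
- by move=> t; exact: cov_U_isometric.
- by move=> xi; rewrite /UT ai_s1 cov_U1.
- by move=> t u xi; rewrite /UT (ai_sM ai) cov_UM.
- move=> t f xi f0; rewrite /UT ai_sV -cov_covariant; last exact: C0Q.
  congr (cov_pi _ _ _); apply/funext => x.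
  rewrite -[x in RHS](ai_QP ai) (ai_alpha ai) /=; congr (alpha _ _ _).
  by apply/funext => y; rewrite /= (ai_PQ ai).
Defined.

Lemma integrated_transport F :
  integrated cov_transport F = integrated c (cc_transport F).
Proof.
apply/funext => xi; rewrite /integrated (reindex_fsbigT s) /=; last first.
  by exists r; [exact: ai_sr ai|exact: ai_rs ai].
apply: eq_fsbigr => t _; congr (cov_pi _ _ _); apply/funext => x.
by rewrite /cc_transport (ai_sr ai).
Qed.

End Representation.

(** The reverse inclusion is this lemma for [action_iso_sym]; the two universal norms are then
    suprema of one and the same set. *)
Lemma universal_norm_values F :
  [set nu | exists (E : hilbert_space R) (c : covariant_rep alpha' E),
     nu = op_norm (integrated c (cc_transport F))] `<=`
  [set nu | exists (E : hilbert_space R) (c : covariant_rep alpha E),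
     nu = op_norm (integrated c F)].
Proof.
by move=> nu [E [c ->]]; exists E, (cov_transport c); rewrite integrated_transport.
Qed.

Lemma cc_alg_transport F : cc_alg F -> cc_alg (cc_transport F).
Proof.
move=> [fF F0]; split=> [|t]; last first.
  exact: C0_comp (ai_PQ ai) (ai_QP ai) (ai_P ai) (ai_Q ai) _.
apply: (@sub_finite_set _ _ (s @` [set t | F t != cst 0])); last exact: finite_image.
move=> t /= nz; exists (r t); last by rewrite (ai_rs ai).
by apply: contra nz => /eqP Ft; apply/eqP/funext => x; rewrite /cc_transport Ft.
Qed.

Lemma cc_transport_mul F F' :
  cc_transport (cc_mul alpha F F') = cc_mul alpha' (cc_transport F) (cc_transport F').
Proof.
apply/funext => t; apply/funext => x; rewrite /cc_transport /cc_mul.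
rewrite [RHS](reindex_fsbigT s) /=; last first.
  by exists r; [exact: ai_sr ai|exact: ai_rs ai].
apply: eq_fsbigr => u _; rewrite (ai_sr ai); congr (_ * _).
rewrite -[x in RHS](ai_QP ai) (ai_alpha ai); congr (alpha _ _ _).
apply/funext => y /=; rewrite (ai_PQ ai); congr (F' _ _).
by apply: (can_inj (ai_sr ai)); rewrite (ai_rs ai) (ai_sM ai) ai_sV (ai_rs ai).
Qed.

Lemma cc_transport_star F :
  cc_transport (cc_star alpha F) = cc_star alpha' (cc_transport F).
Proof.
apply/funext => t; apply/funext => x; rewrite /cc_transport /cc_star.
rewrite -[t in RHS](ai_rs ai) -[x in RHS](ai_QP ai) (ai_alpha ai).
congr (alpha _ _ _); apply/funext => y /=; rewrite (ai_PQ ai); congr ((F _ _)^*).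
by apply: (can_inj (ai_sr ai)); rewrite ai_sV !(ai_rs ai).
Qed.

End ActionIso.

Section CrossedProductIso.
Variables (R : realType) (X X' : topologicalType) (G G' : groupType).
Variables (alpha : G -> (X -> CC R) -> (X -> CC R)).
Variables (alpha' : G' -> (X' -> CC R) -> (X' -> CC R)).
Variables (P : X -> X') (Q : X' -> X) (s : G -> G') (r : G' -> G).
Hypothesis ai : action_iso alpha alpha' P Q s r.

Lemma cc_transportK : cancel (@cc_transport R X X' G G' Q r) (cc_transport P s).
Proof.
move=> F; apply/funext => t; apply/funext => x.
by rewrite /cc_transport (ai_sr ai) (ai_PQ ai).
Qed.

Lemma universal_norm_transport F :
  universal_norm alpha' (cc_transport Q r F) = universal_norm alpha F.
Proof.
congr (sup _); apply/seteqP; split; first exact: (universal_norm_values ai).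
have := @universal_norm_values _ _ _ _ _ _ _ _ _ _ _ (action_iso_sym ai) (cc_transport Q r F).
by rewrite cc_transportK.
Qed.

Hypothesis alpha_C0 : forall t f, C0 R X f -> C0 R X (alpha t f).
Hypothesis alpha0 : forall t, alpha t (cst 0) = cst 0.

(** Composing [cp_in A'] with the transport presents [A'] as a completion of the convolution algebra
    of [alpha] in the same norm as [A]. *)
Lemma crossed_product_iso (A : crossed_product alpha) (A' : crossed_product alpha') :
  cstar_iso A A'.
Proof.
pose j (F : G -> X -> CC R) : A' := cp_in A' (cc_transport Q r F).
have tD (F : G -> X -> CC R) : cc_alg F -> cc_alg (cc_transport Q r F).
  by move=> DF; exact: (cc_alg_transport ai DF).
have iso := @dense_star_hom_iso R (G -> X -> CC R) (@cc_alg R X G) (@cc_lin R X G)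
  (cc_mul alpha) (cc_star alpha).
refine (iso _ _ _ A A' (cp_in A) j _ _ _) => {iso}.
- exact: cc_alg_lin.
- exact: cc_alg_mul.
- exact: cc_alg_star.
- split.
  + exact: cp_in_lin.
  + exact: cp_in_mul.
  + exact: cp_in_star.
  + exact: cp_dense.
- split.
  + by move=> c F F' DF DF'; exact: (@cp_in_lin _ _ _ _ A' c _ _ (tD _ DF) (tD _ DF')).
  + by move=> F F' DF DF'; rewrite /j (cc_transport_mul ai) cp_in_mul //; exact: tD.
  + by move=> F DF; rewrite /j (cc_transport_star ai) cp_in_star //; exact: tD.
  + rewrite (_ : j @` _ = cp_in A' @` (@cc_alg R X' G')); first exact: cp_dense.
    apply/seteqP; split=> [_ [F DF <-]|_ [F DF <-]].
      by exists (cc_transport Q r F) => //; exact: tD.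
    exists (cc_transport P s F); first exact: (cc_alg_transport (action_iso_sym ai) DF).
    congr (cp_in _ _); apply/funext => t; apply/funext => x.
    by rewrite /cc_transport (ai_rs ai) (ai_QP ai).
- move=> F DF; rewrite cp_in_norm // /j cp_in_norm ?universal_norm_transport //.
  exact: tD.
Qed.

End CrossedProductIso.

(** * Comparing the sequences a and b *)

(** These are the [m] for which [m Z] belongs to [adicU], that is, the orders of the quotients of
    the closure of Z by its open subgroups. *)
Definition pos_divisor (a : adic_seq) (m : nat) : Prop :=
  exists j, (m %| pos_prod a j)%N.

Section AdicElements.
Variable a : adic_seq.
Implicit Types n x y : adicN a.

Lemma pos_prod_gt0 j : (0 < pos_prod a j)%N.
Proof. by apply: prodn_gt0 => i; apply: leq_trans (adic_ge2 a _). Qed.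

Lemma dvdn_pos_prod i j : (i <= j)%N -> (pos_prod a i %| pos_prod a j)%N.
Proof.
move=> ij; rewrite /pos_prod (@big_cat_nat _ _ _ i.+1 0 j.+1) //=.
exact: dvdn_mulr.
Qed.

Lemma pos_divisor_gt0 m : pos_divisor a m -> (0 < m)%N.
Proof. by move=> [j mj]; exact: dvdn_gt0 (pos_prod_gt0 j) mj. Qed.

Lemma pos_divisor_dvd m m' : (m %| m')%N -> pos_divisor a m' -> pos_divisor a m.
Proof. by move=> mm' [j m'j]; exists j; exact: dvdn_trans m'j. Qed.

Lemma pos_divisor_lcm m m' :
  pos_divisor a m -> pos_divisor a m' -> pos_divisor a (lcmn m m').
Proof.
move=> [i mi] [j mj]; exists (maxn i j); rewrite dvdn_lcm.
by rewrite (dvdn_trans mi) ?(dvdn_trans mj) // dvdn_pos_prod // ?leq_maxl ?leq_maxr.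
Qed.

Lemma one_in_N : 1 \in in_N a.
Proof.
by have := @in_N_dvd a 1 1 1 (dvd1n _); rewrite divr1.
Qed.

Definition N_one : adicN a := AdicN one_in_N.

Lemma N_valMz n (z : int) : N_val (n *~ z) = z%:~R * N_val n.
Proof. by rewrite -[LHS]/(val _) raddfMz -mulrzl. Qed.

Lemma N_val_oneMz (z : int) : N_val (N_one *~ z) = z%:~R.
Proof. by rewrite N_valMz mulr1. Qed.

Lemma N_oneMz_inj (z z' : int) : N_one *~ z = N_one *~ z' -> z = z'.
Proof. by move/(congr1 (@N_val a)); rewrite !N_val_oneMz => /intr_inj. Qed.

Definition multiples (m : nat) : set (adicN a) :=
  [set n | exists z : int, n = N_one *~ (m%:Z * z)].

Lemma multiplesE m n : multiples m n <-> exists z : int, N_val n = z%:~R * m%:R.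
Proof.
split=> -[z nz]; exists z; last apply: val_inj => /=.
  by rewrite nz N_val_oneMz rmorphM /= mulrC.
by rewrite N_val_oneMz nz rmorphM /= mulrC.
Qed.

Lemma multiples_sub m x y : multiples m x -> multiples m y -> multiples m (x - y).
Proof. by move=> [z ->] [z' ->]; exists (z - z'); rewrite -mulrzBr -mulrBr. Qed.

Lemma adicU_multiples m : pos_divisor a m -> adicU (multiples m).
Proof.
move=> md; exists m, 1%N; split; [|by []| |].
- by rewrite (pos_divisor_gt0 md).
- by exists 1%N; rewrite dvd1n.
- apply/seteqP; split=> n /=; rewrite -/(multiples m n).
    by rewrite multiplesE => -[z nz]; exists z; rewrite divr1.
  by move=> [z nz]; apply/multiplesE; exists z; rewrite nz divr1.
Qed.

(** [m Z] lies in [(m / n) Z], so the subgroups of Z in [adicU] already form a neighbourhood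
    basis. *)
Lemma adicU_sup_multiples V : adicU V ->
  exists2 m, pos_divisor a m & multiples m `<=` V.
Proof.
move=> [m [n [[m0 n0] md nd ->]]]; exists m => // x /multiplesE[z xz] /=.
exists (z * n%:Z); rewrite xz rmorphM /= -mulrA; congr (_ * _).
by rewrite mulrC divfK // pnatr_eq0 -lt0n.
Qed.

Section Trace.
Variable O : Omega a.

(** The trace is a subgroup of Z, nonzero because it contains a basic subgroup [m' Z]; its least
    positive element [m] generates it and divides [m']. *)
Lemma open_subgroup_trace (W : set O) : open_subgroup W ->
  (forall n, W (hc_in O n) -> multiples 1 n) ->
  exists2 m, pos_divisor a m & forall n, W (hc_in O n) <-> multiples m n.
Proof.
move=> oW W1; have [V UV VW] := hc_continuous oW.1.
have [m' m'd m'V] := adicU_sup_multiples UV.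
have exW : exists k, (0 < k)%N && `[< W (hc_in O (N_one *~ k)) >].
  exists m'; rewrite (pos_divisor_gt0 m'd); apply/asboolP/VW/m'V.
  by exists 1; rewrite mulr1.
case: (ex_minnP exW) => m /andP[m0 /asboolP Wm] min_m.
have Wz z : W (hc_in O (N_one *~ z)) -> (m %| z)%Z.
  move=> Wz; rewrite -[(_ %| _)%Z]negbK; apply/negP => nd.
  have mz : (m : int) != 0 by rewrite -lt0n in m0 *; case: (m) m0.
  have r0 := modz_ge0 z mz; have rm := ltz_pmod z (_ : 0 < m%:Z).
  have : W (hc_in O (N_one *~ (z %% m)%Z)).
    rewrite (_ : (z %% m)%Z = z - m%:Z * (z %/ m)%Z); last first.
      by rewrite /modz mulrC.
    rewrite mulrzBr raddfB; apply: oW.2 => //.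
    by rewrite mulrzA raddfMz; exact: open_subgroupMz.
  have {}nd : (z %% m)%Z != 0 by apply: contra nd => /eqP/dvdz_mod0P.
  move: r0 rm nd; case: (z %% m)%Z => // k _ /(_ m0) km; rewrite eqz_nat -lt0n => k0 Wk.
  have := min_m k; rewrite k0 leqNgt -ltz_nat km => no.
  by suff : false by []; apply: no; exact/asboolP.
exists m.
  have : (m %| m'%:Z)%Z by apply/Wz/VW/m'V; exists 1; rewrite mulr1.
  by move=> mm'; exact: pos_divisor_dvd m'd.
move=> n; split=> [Wn|[z ->]].
  have [z nz] := W1 n Wn; rewrite mul1r in nz.
  have /dvdzP[k zk] : (m %| z)%Z by apply: Wz; rewrite -nz.
  by exists k; rewrite nz zk mulrC.
by rewrite mulrzA raddfMz; exact: open_subgroupMz.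
Qed.

End Trace.

End AdicElements.

(** The part of the isomorphism that survives: multiplication by [n / m] matches [N_a] with [N_b]
    and the basic subgroups [m l Z] with [n l Z]. *)
Definition commensurable (a b : adic_seq) (m n : nat) : Prop :=
  [/\ pos_divisor a m, pos_divisor b n,
      (forall l, pos_divisor a (m * l) <-> pos_divisor b (n * l)) &
      forall q, q \in in_N a <-> n%:R / m%:R * q \in in_N b].

Lemma commensurable_sym a b m n : commensurable a b m n -> commensurable b a n m.
Proof.
move=> [ma nb mnl mnq]; split=> // [l|q]; first by rewrite mnl.
rewrite mnq; set q' := _ * (_ * q); suff -> : q' = q by [].
have := pos_divisor_gt0 ma; have := pos_divisor_gt0 nb; rewrite /q' => n0 m0.
by field; rewrite !pnatr_eq0 -!lt0n m0 n0.
Qed.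

(** * From a topological isomorphism to commensurability *)

Section TopGroupIso.
Variables (a b : adic_seq) (Oa : Omega a) (Ob : Omega b).
Variables (f : Oa -> Ob) (g : Ob -> Oa).
Hypotheses (fB : {morph f : x y / x - y}) (gB : {morph g : x y / x - y}).
Hypotheses (fK : cancel f g) (gK : cancel g f).
Hypotheses (cf : continuous f) (cg : continuous g).

Lemma common_open_subgroup : exists2 W : set Oa, open_subgroup W &
  exists m n, [/\ pos_divisor a m, pos_divisor b n,
    (forall x, W (hc_in Oa x) <-> multiples m x) &
    (forall y, W (g (hc_in Ob y)) <-> multiples n y)].
Proof.
(* The divisor 1 yields open subgroups with trace Z; intersecting them makes both traces of [W]
   consist of integers. *)
have one_div c : pos_divisor c 1 by exists 0%N; rewrite dvd1n.
have [A oA Aa] := completion_open_subgroup Oa (adicU_multiples (one_div a))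
  (@multiples_sub a 1).
have [B oB Bb] := completion_open_subgroup Ob (adicU_multiples (one_div b))
  (@multiples_sub b 1).
have oW : open_subgroup (A `&` f @^-1` B).
  by apply: open_subgroupI => //; exact: open_subgroup_preim.
exists (A `&` f @^-1` B) => //.
have [|m ma Wm] := open_subgroup_trace oW; first by move=> x [/Aa].
have [|n nb Wn] := open_subgroup_trace (open_subgroup_preim gB cg oW).
  by move=> y [_]; rewrite /preimage /= gK => /Bb.
by exists m, n.
Qed.

Variables (W : set Oa) (m n : nat).
Hypotheses (oW : open_subgroup W) (ma : pos_divisor a m).
Hypothesis Wa : forall x, W (hc_in Oa x) <-> multiples m x.
Hypothesis Wb : forall y, W (g (hc_in Ob y)) <-> multiples n y.

(** The image of [x] under [f] may lie outside [N_b], but modulo an open subgroup it is represented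
    by some [y] in [N_b]. *)
Lemma iso_approx (V : set Oa) (x : adicN a) : open_subgroup V ->
  exists y : adicN b, V (g (hc_in Ob y) - hc_in Oa x).
Proof.
move=> oV; have [y] := completion_approx (f (hc_in Oa x)) (open_subgroup_preim gB cg oV).
by rewrite /preimage /= gB fK; exists y.
Qed.

Lemma iso_approxMz (V : set Oa) (x : adicN a) (y : adicN b) (z : int) :
  open_subgroup V -> V (g (hc_in Ob y) - hc_in Oa x) ->
  V (g (hc_in Ob (y *~ z))) <-> V (hc_in Oa (x *~ z)).
Proof.
move=> oV Vyx.
have gMz u : g (u *~ z) = g u *~ z.
  have g0 : g 0 = 0 by rewrite -(subrr 0) gB subrr.
  have gN v : g (- v) = - g v by rewrite -sub0r gB g0 sub0r.
  have gD v w : g (v + w) = g v + g w by rewrite -[w in LHS]opprK gB gN opprK.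
  have gn v k : g (v *+ k) = g v *+ k.
    by elim: k => [|k IH]; rewrite ?mulr0n // !mulrS gD IH.
  by case: z => k; [exact: gn|rewrite !NegzE !mulrNz gN gn].
rewrite !raddfMz gMz; apply: iff_sym; apply: open_subgroup_subr => //.
by rewrite -mulrzBl; exact: open_subgroupMz.
Qed.

Let m0 : (m%:R : rat) != 0. Proof. by rewrite pnatr_eq0 -lt0n (pos_divisor_gt0 ma). Qed.

(* The class of [m / t] has order exactly [t] modulo [W]. *)
Lemma iso_quotient (t : nat) : (0 < t)%N ->
  m%:R / t%:R \in in_N a -> n%:R / t%:R \in in_N b.
Proof.
move=> t0 mt; have t0' : (t%:R : rat) != 0 by rewrite pnatr_eq0 -lt0n.
have [y Vyx] := iso_approx (AdicN mt) oW.
have yW z := iso_approxMz z oW Vyx; have := yW t; rewrite Wa Wb => -[_ ty].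
have [|z yz] := ty.
  exists 1; apply: val_inj; rewrite /= -/(N_val _) N_val_oneMz N_valMz mulr1 /=.
  by rewrite mulrCA mulfV // mulr1.
have {}yz : N_val y = n%:R * z%:~R / t%:R.
  apply: (mulfI t0'); have := congr1 (@N_val b) yz.
  by rewrite N_valMz N_val_oneMz rmorphM /= => ->; field.
(* With [e] the gcd and [t' = t / e], the multiple [t' y] lies in [n Z], hence [t'] times [m / t],
   which is [m / e], lies in [m Z]. So [e] is 1. *)
have ztc : gcdz z t = 1.
  have /dvdzP[z' zE] := dvdz_gcdl z t; have /dvdzP[t' tE] := dvdz_gcdr z t.
  move: zE tE; set e := gcdz z t => zE tE.
  have [e0 t'0] : e%:~R != 0 :> rat /\ t'%:~R != 0 :> rat.
    by apply/andP; rewrite -negb_or orbC -mulf_eq0 -rmorphM -tE.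
  have tE' : t%:R = t'%:~R * e%:~R :> rat by rewrite -rmorphM -tE.
  have [w wE] : multiples m (AdicN mt *~ t').
    rewrite -Wa -yW Wb; apply/multiplesE; exists z'.
    by rewrite N_valMz yz tE' zE rmorphM /=; field; rewrite e0 t'0.
  have we : w * e = 1.
    apply: (@intr_inj rat); apply: (mulfI m0).
    have /(congr1 (@N_val a)) := wE; rewrite N_valMz N_val_oneMz rmorphM /= tE'.
    move=> /esym mw; rewrite rmorphM /= mulrA [m%:R * w%:~R]mw.
    by field; rewrite e0 t'0.
  move/(congr1 absz): we; rewrite abszM => /eqP; rewrite muln_eq1 => /andP[_ /eqP].
  by rewrite /e /gcdz /= => ->.
(* As [y = n z / t], Bezout turns [u y + n v] into [n / t]. *)
have [u [v uv]] := Bezoutz z t.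
rewrite (_ : _ / _ = N_val (y *~ u + N_one b *~ (n%:Z * v))); first exact: N_valP.
have {}uv : u%:~R * z%:~R + v%:~R * t%:R = 1 :> rat.
  by rewrite -[t%:R]/(t%:~R) -!rmorphM -rmorphD uv ztc.
rewrite -[RHS]/(val _) raddfD /= -/(N_val _) -/(N_val _) N_valMz N_val_oneMz yz rmorphM /=.
apply: (mulIf t0'); rewrite divfK //.
transitivity (n%:R * (u%:~R * z%:~R + v%:~R * t%:R) : rat); first by rewrite uv mulr1.
by field.
Qed.

(** Write [q / m] in lowest terms as [c / d]. By Bezout [m / d] lies in the group generated by [q]
    and [m]; [iso_quotient] then gives [n / d], and [c] times it is the required element. *)
Lemma iso_in_N q : q \in in_N a -> n%:R / m%:R * q \in in_N b.
Proof.
move=> qN; pose r := q / m%:R; have qE : q = m%:R * r by rewrite mulrC divfK.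
have t0 : (0 < `|denq r|)%N by rewrite absz_gt0 denq_neq0.
have tE : (`|denq r|)%:R = (denq r)%:~R :> rat.
  by rewrite natr_absz gtr0_norm // denq_gt0.
have d0 : (denq r)%:~R != 0 :> rat by rewrite intr_eq0 denq_neq0.
have rE : r = (numq r)%:~R / (denq r)%:~R by rewrite divq_num_den.
have nt : n%:R / (`|denq r|)%:R \in in_N b.
  apply: iso_quotient => //.
  have [u [v uv]] := Bezoutz (numq r) (denq r).
  have {}uv : u%:~R * (numq r)%:~R + v%:~R * (denq r)%:~R = 1 :> rat.
    have /eqP cop : coprimez (numq r) (denq r) by rewrite coprimezE; exact: coprime_num_den.
    by rewrite -!rmorphM -rmorphD uv cop.
  rewrite (_ : _ / _ = N_val (AdicN qN *~ u + N_one a *~ (m%:Z * v))); first exact: N_valP.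
  rewrite -[RHS]/(val _) raddfD /= -/(N_val _) -/(N_val _) N_valMz N_val_oneMz rmorphM /=.
  rewrite qE [in RHS]rE tE; apply: (mulIf d0); rewrite divfK //.
  transitivity (m%:R * (u%:~R * (numq r)%:~R + v%:~R * (denq r)%:~R) : rat).
    by rewrite uv mulr1.
  by field.
rewrite (_ : _ * q = N_val (AdicN nt *~ numq r)); first exact: N_valP.
by rewrite N_valMz /= tE qE {1}rE; field; rewrite m0 d0.
Qed.

(** An open subgroup with trace [m l Z] on [N_a], cut down to [W], has a trace [n l' Z] on [N_b]. To
    see that [l] divides [l'], let [y] represent the class of [m]: it lies in [n Z], so [l' y] is in
    the trace, hence [m l'] lies in [m l Z]. *)
Lemma iso_pos_divisor l : pos_divisor a (m * l) -> pos_divisor b (n * l).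
Proof.
move=> mla.
have [V oV Vml] := completion_open_subgroup Oa (adicU_multiples mla) (@multiples_sub a _).
have oVW := open_subgroupI oV oW.
have [|d db Vd] := open_subgroup_trace (open_subgroup_preim gB cg oVW).
  by move=> y [_ /Wb[z ->]]; exists (n%:Z * z); rewrite mul1r.
have [l' dl'] : exists l', d = (n * l')%N.
  have /Vd[_ /Wb[z dz]] : multiples d (N_one b *~ d) by exists 1; rewrite mulr1.
  exists `|z|%N; move/N_oneMz_inj: dz => /(congr1 absz).
  by rewrite abszM.
suff ll' : (l %| l')%N.
  by apply: pos_divisor_dvd db; rewrite dl' dvdn_mul.
have [y VWy] := iso_approx (N_one a *~ m) oVW.
have yV z := iso_approxMz z oVW VWy.
have Wm : W (hc_in Oa (N_one a *~ m)) by apply/Wa; exists 1; rewrite mulr1.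
have Wy : W (g (hc_in Ob y)) by apply: (iso_approxMz 1 oW VWy.2).2.
have [z yz] := (Wb y).1 Wy.
have : V (hc_in Oa (N_one a *~ m *~ l')).
  suff [] : (V `&` W) (hc_in Oa (N_one a *~ m *~ l')) by [].
  rewrite -yV; apply/Vd; exists z; rewrite yz -mulrzA dl' PoszM; congr (_ *~ _).
  by rewrite mulrAC.
rewrite Vml -mulrzA => -[w /N_oneMz_inj].
rewrite PoszM -mulrA => /(congr1 absz) /eqP; rewrite !abszM /= eqn_pmul2l ?(pos_divisor_gt0 ma) //.
by move=> /eqP ->; exact: dvdn_mulr.
Qed.

End TopGroupIso.

Lemma topgroup_iso_commensurable a b (Oa : Omega a) (Ob : Omega b) :
  topgroup_iso Oa Ob -> exists m n, commensurable a b m n.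
Proof.
move=> [f [g [fK gK cf cg]]].
have fB : {morph f : x y / x - y} by exact: raddfB.
have gB : {morph g : x y / x - y}.
  by move=> x y; apply: (can_inj fK); rewrite fB !gK.
have [W oW [m [n [ma nb Wa Wb]]]] := common_open_subgroup fB gB gK cf cg.
(* The preimage of [W] under [g] takes the part of [W] for the inverse isomorphism, which yields the
   converse implications. *)
have oW' := open_subgroup_preim gB cg oW.
have Wa' x : (g @^-1` W) (f (hc_in Oa x)) <-> multiples m x.
  by rewrite /preimage /= fK.
exists m, n; split=> // [l|q]; split.
- exact: (iso_pos_divisor gB fK cg oW ma Wa Wb).
- exact: (iso_pos_divisor fB gK cf oW' nb Wb Wa').
- exact: (iso_in_N gB fK cg oW ma Wa Wb).
- move=> /(iso_in_N fB gK cf oW' nb Wb Wa'); set q' := _ * _.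
  suff -> : q' = q by [].
  have := pos_divisor_gt0 ma; have := pos_divisor_gt0 nb; rewrite /q' => n0 m0.
  by field; rewrite !pnatr_eq0 -!lt0n m0 n0.
Qed.

(** * Recovering P_a and S_a from the commensurability data *)

Lemma finite_nat_bounded (A : set nat) : finite_set A -> exists K, A `<=` `I_K.
Proof.
move=> fA; exists (\max_(i <- fset_set A) i).+1 => i Ai.
by rewrite /= ltnS; apply: leq_bigmax_seq; rewrite // in_fset_set // inE.
Qed.

Section PrimeMultiplicity.
Variables (s : nat -> nat) (p : nat).
Hypotheses (s_gt0 : forall i, (0 < s i)%N) (pp : prime p).

Let P k := (\prod_(0 <= i < k) s i)%N.

Let PS k : P k.+1 = (P k * s k)%N.
Proof. by rewrite /P big_nat_recr. Qed.

Let P_dvd k l : (k <= l)%N -> (P k %| P l)%N.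
Proof.
by move=> kl; rewrite /P (@big_cat_nat _ _ _ k 0 l) //=; exact: dvdn_mulr.
Qed.

(** Each new factor divisible by [p] makes room for one more [p]. If such factors run out before
    [K], the exponent of [p] is already maximal in [P K]. This expresses the conditions in [adicP]
    through divisors. *)
Lemma infinite_dvd_prod : infinite_set [set i | (p %| s i)%N] <->
  forall M, (exists k, M %| P k)%N -> (exists k, p * M %| P k)%N.
Proof.
split=> [infp M [k Mk]|pM finp].
  have [l kl pl] : exists2 l, (k <= l)%N & (p %| s l)%N.
    apply: contrapT => no; apply: infp.
    apply: (@sub_finite_set _ _ `I_k); last exact: finite_II.
    by move=> i /= pi; rewrite ltnNge; apply/negP => ki; apply: no; exists i.
  by exists l.+1; rewrite PS mulnC; apply: dvdn_mul => //; exact: dvdn_trans (P_dvd kl).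
have [K KP] := finite_nat_bounded finp.
have powK e k : (p ^ e %| P k)%N -> (p ^ e %| P K)%N.
  elim: k => [|k IH]; first by move=> /dvdn_trans; apply; exact: P_dvd.
  have [kK|Kk] := ltnP k K; first by move=> /dvdn_trans; apply; exact: P_dvd.
  rewrite PS Gauss_dvdl //; apply: coprimeXl; rewrite prime_coprime //.
  by apply/negP => /KP /=; rewrite ltnNge Kk.
have pow e : exists k, (p ^ e %| P k)%N.
  by elim: e => [|e IH]; [exists 0%N; rewrite expn0 dvd1n|rewrite expnS; exact: pM].
have PK0 : (0 < P K)%N by apply: prodn_gt0.
(* The exponent [P K] is large enough: [p ^ P K] would divide [P K] but exceeds it. *)
have [k /powK /(dvdn_leq PK0)] := pow (P K).
by rewrite leqNgt ltn_expl // prime_gt1.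
Qed.

End PrimeMultiplicity.

Section AdicPrimes.
Variables (a : adic_seq) (p : nat).
Hypothesis pp : prime p.

Let a_gt0 i : (0 < a i)%N. Proof. exact: leq_trans (adic_ge2 a i). Qed.

Lemma infinite_pos_divisor :
  infinite_set [set k : int | (0 <= k)%R /\ (p %| a k)%N] <->
  forall M, pos_divisor a M -> pos_divisor a (p * M).
Proof.
have -> : infinite_set [set k : int | (0 <= k)%R /\ (p %| a k)%N] <->
    infinite_set [set i : nat | (p %| a i%:Z)%N].
  split; apply: contra_not => fin.
    apply: sub_finite_set (finite_image Posz fin) => k [k0 pk].
    by exists `|k|%N; rewrite /= ?gez0_abs.
  apply: sub_finite_set (finite_image absz fin) => i /= pi.
  by exists i%:Z.
rewrite (infinite_dvd_prod (fun i => a_gt0 i%:Z) pp).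
have posE M : pos_divisor a M <-> exists k, (M %| \prod_(0 <= i < k) a i%:Z)%N.
  split=> [[j Mj]|[k Mk]]; first by exists j.+1.
  (* [pos_prod a k] has one factor more than the product over [i < k], which preserves
     divisibility. *)
  exists k; apply: dvdn_trans Mk _.
  by rewrite /pos_prod big_nat_recr //=; exact: dvdn_mulr.
by split=> pM M MP; apply/posE/pM; apply/posE.
Qed.

Lemma inv_in_N M : (0 < M)%N ->
  M%:R^-1 \in in_N a <-> exists k, (M %| \prod_(0 <= i < k) a (- i.+1%:Z))%N.
Proof.
move=> M0.
have negE k : neg_prod a k = (\prod_(0 <= i < k) a (- i.+1%:Z))%N.
  by rewrite /neg_prod big_add1.
split=> [/asboolP[j [k [_ Mk]]]|[k Mk]]; last first.
  by rewrite -[_^-1]mul1r; apply: (@in_N_dvd a 1 M k); rewrite negE.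
exists k; rewrite -negE; apply/dvdnP; exists `|j|%N.
have M0' : (M%:R : rat) != 0 by rewrite pnatr_eq0 -lt0n.
have k0 : ((neg_prod a k)%:R : rat) != 0 by rewrite pnatr_eq0 -lt0n neg_prod_gt0.
have : (neg_prod a k)%:R = j%:~R * M%:R :> rat.
  by apply: (mulIf (invr_neq0 M0')); rewrite mulfK // Mk mulrC divfK.
rewrite -[LHS]/((neg_prod a k)%:Z%:~R) -[M%:R]/(M%:Z%:~R) -rmorphM => /intr_inj.
by move=> /(congr1 absz); rewrite abszM.
Qed.

(** Applied to [1 / M], the hypothesis says by [inv_in_N] that the divisors of the products
    [neg_prod] are closed under multiplication by [p]. *)
Lemma infinite_inv_in_N :
  (forall q, q \in in_N a -> p%:R^-1 * q \in in_N a) ->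
  infinite_set [set k : int | (k < 0)%R /\ (p %| a k)%N].
Proof.
move=> pN.
suff : infinite_set [set i : nat | (p %| a (- i.+1%:Z))%N].
  apply: contra_not => fin.
  apply: sub_finite_set (finite_image (fun k => `|k|.-1) fin) => i /= pi.
  by exists (- i.+1%:Z).
apply/(infinite_dvd_prod (fun i => a_gt0 (- i.+1%:Z)) pp) => M [k Mk].
have M0 : (0 < M)%N by apply: dvdn_gt0 Mk; exact: prodn_gt0.
apply/inv_in_N; first by rewrite muln_gt0 prime_gt0.
by rewrite natrM invfM; apply/pN/inv_in_N => //; exists k.
Qed.

End AdicPrimes.

Lemma adicP_pos_divisor a p M : adicP a p -> pos_divisor a M -> pos_divisor a (p * M).
Proof. by move=> [pp _ /(infinite_pos_divisor a pp)]; exact. Qed.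

Lemma commensurable_adicP a b m n : commensurable a b m n -> adicP a `<=` adicP b.
Proof.
move=> mn p Pp; have [ma nb mnl mnq] := mn; have [pp _ _] := Pp.
have m0 : (m%:R : rat) != 0 by rewrite pnatr_eq0 -lt0n (pos_divisor_gt0 ma).
have n0 : (n%:R : rat) != 0 by rewrite pnatr_eq0 -lt0n (pos_divisor_gt0 nb).
split=> //.
  apply: infinite_inv_in_N => // q qN.
  have [_ _ _ nmq] := commensurable_sym mn.
  have := (P_mul_in_N Pp ((nmq q).1 qN)).2; rewrite mnq.
  rewrite (_ : n%:R / m%:R * _ = p%:R^-1 * q) //.
  by field; rewrite m0 n0 pnatr_eq0 -lt0n prime_gt0.
(* Only multiples of [n] can be compared, so [M] is enlarged to [lcmn n M = n l], moved to [m l],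
   multiplied by [p] and moved back. *)
apply/infinite_pos_divisor => // M /(pos_divisor_lcm nb) nM.
have /dvdnP[l lE] := dvdn_lcml n M; rewrite mulnC in lE.
rewrite lE -mnl in nM; have := adicP_pos_divisor Pp nM.
rewrite mulnCA mnl; apply: pos_divisor_dvd.
by rewrite mulnCA -lE dvdn_mul // dvdn_lcmr.
Qed.

Lemma commensurable_adicS a b m n : commensurable a b m n -> adicS a = adicS b.
Proof.
move=> mn; rewrite /adicS (_ : adicP a = adicP b) //.
apply/seteqP; split; first exact: (commensurable_adicP mn).
exact: (commensurable_adicP (commensurable_sym mn)).
Qed.

(** This is continuity at 0 of multiplication by [h], which maps [M' Z] into [M Z]. Imposed on [h]
    and its inverse together, it defines a subgroup, so the generators suffice: [M' = M] serves [p],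
    and [M' = p M] its inverse. *)
Lemma adicS_pos_divisor a h M : adicS a h -> pos_divisor a M ->
  exists2 M', pos_divisor a M' & exists z : int, h * M'%:R = z%:~R * M%:R.
Proof.
pose Q (x : rat) := forall M, pos_divisor a M ->
  exists2 M', pos_divisor a M' & exists z : int, x * M'%:R = z%:~R * M%:R.
have QM x y : Q x -> Q y -> Q (x * y).
  move=> Qx Qy k kd; have [k' k'd [z zE]] := Qx k kd.
  have [k'' k''d [z' z'E]] := Qy k' k'd; exists k'' => //; exists (z * z').
  by rewrite -mulrA z'E mulrCA zE rmorphM /= mulrA [z%:~R * _]mulrC.
pose K := [set x : rat | [/\ 0 < x, Q x & Q x^-1]].
move=> Sh; suff [_ Qh _] : K h by exact: Qh.
apply: (Sh K); split.
  split; first by move=> x [].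
  - by split=> // k kd; exists k => //; exists 1; rewrite ?invr1 mulr1z.
  - by move=> x y [x0 Qx Qx'] [y0 Qy Qy']; split;
      [exact: mulr_gt0|exact: QM|rewrite invfM; exact: QM].
  - by move=> x [x0 Qx Qx']; split; rewrite ?invr_gt0 ?invrK.
move=> _ [p Pp <-]; have p0 : (0 < p)%N by case: Pp => /prime_gt0.
split; first by rewrite ltr0n.
  by move=> k kd; exists k => //; exists p%:Z.
move=> k kd; exists (p * k)%N; first exact: adicP_pos_divisor.
by exists 1; rewrite natrM mulKf ?mulr1z ?mul1r // pnatr_eq0 -lt0n.
Qed.

(** * Multiplication by H on Omega_a *)

Section OmegaMul.
Variables (a : adic_seq) (H : set rat) (HS : nontrivial_subgroup_of (adicS a) H).
Variable O : Omega a.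
Local Notation elt := (subgroup_elt HS).
Implicit Types (h : elt) (x : O).

Lemma smulB h : {morph smul h : x y / x - y}.
Proof. by move=> x y; apply: val_inj; rewrite /= mulrBr. Qed.

Lemma smul_continuous h V : adicU V -> exists2 W, adicU W & W `<=` smul h @^-1` V.
Proof.
move=> /adicU_sup_multiples[M Md MV].
have Sh : adicS a (val h) by case: (HS) => _ HSa _; apply: HSa; exact: elt_in h.
have [M' M'd [z zE]] := adicS_pos_divisor Sh Md.
exists (multiples M'); first exact: adicU_multiples.
move=> x /multiplesE[w xw]; apply/MV/multiplesE; exists (w * z).
by rewrite /= xw mulrCA zE rmorphM /= mulrA.
Qed.

Lemma omega_mulP h : continuous (@omega_mul a H HS O h) /\
  forall n, omega_mul h (hc_in O n) = hc_in O (smul h n).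
Proof.
have [G cG Gin] := completion_extension O O (@smulB h) (@smul_continuous h).
rewrite /omega_mul; case: xgetP => [g _ //|/(_ G)]; by case.
Qed.

Lemma continuous_eq_on_N (T : topologicalType) (f g : O -> T) :
  hausdorff_space T -> continuous f -> continuous g ->
  (forall n, f (hc_in O n) = g (hc_in O n)) -> f = g.
Proof.
move=> hT cf cg fg; apply: (continuous_dense_eq hT (@hc_dense _ _ O)) => //.
by move=> _ [n _ <-].
Qed.

Lemma omega_mulK h : cancel (omega_mul h : O -> O) (omega_mul (eltV h)).
Proof.
suff E : omega_mul (eltV h) \o omega_mul h = @id O by move=> x; exact: (congr1 (@^~ x) E).
have [ch hin] := omega_mulP h; have [cV Vin] := omega_mulP (eltV h).
apply: continuous_eq_on_N; first exact: hc_hausdorff.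
- by move=> x; apply: continuous_comp; [exact: ch|exact: cV].
- by move=> x; exact: cvg_id.
- move=> n; rewrite /= hin Vin; congr (hc_in O _); apply: val_inj => /=.
  by rewrite mulrA mulVf ?mul1r // elt_neq0.
Qed.

Lemma eltVK h : eltV (eltV h) = h.
Proof. by apply: val_inj; rewrite /= invrK. Qed.

Lemma alpha_aff_C0 (R : realType) (s : semidirect HS) (f : O -> CC R) :
  C0 R O f -> C0 R O (alpha_aff s f).
Proof.
pose P (y : O) := hc_in O s.1 + omega_mul s.2 y.
pose Q (x : O) := omega_mul (eltV s.2) (x - hc_in O s.1).
apply: (@C0_comp R O O P Q f).
- by move=> y; rewrite /P /Q addrC addKr omega_mulK.
- by move=> x; rewrite /P /Q -{1}(eltVK s.2) omega_mulK addrC subrK.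
- move=> y; apply: (@continuous_comp _ _ _ (omega_mul s.2) (fun z => hc_in O s.1 + z)).
    exact: (omega_mulP _).1.
  exact: addl_continuous.
- move=> x; apply: (@continuous_comp _ _ _ (fun z => z - hc_in O s.1) (omega_mul (eltV s.2))).
    exact: subr_continuous.
  exact: (omega_mulP _).1.
Qed.

End OmegaMul.

(** * The scaling by n / m and its equivariance *)

Section Scaling.
Variables (a b : adic_seq) (m n : nat).
Hypothesis mn : commensurable a b m n.

Lemma scaling_in_N (x : adicN a) : n%:R / m%:R * N_val x \in in_N b.
Proof. by have [_ _ _ mnq] := mn; exact/mnq/N_valP. Qed.

Definition scaling (x : adicN a) : adicN b := AdicN (scaling_in_N x).

Lemma scalingB : {morph scaling : x y / x - y}.
Proof. by move=> x y; apply: val_inj; rewrite /= mulrBr. Qed.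

(** [M Z] is shrunk to the multiples [n l Z] of [lcmn n M], and multiplication by [n / m] maps
    [m l Z] onto [n l Z]. *)
Lemma scaling_continuous V : adicU V ->
  exists2 W, adicU W & W `<=` scaling @^-1` V.
Proof.
move=> /adicU_sup_multiples[M Md MV]; have [ma nb mnl _] := mn.
have := pos_divisor_lcm nb Md; have /dvdnP[l lE] := dvdn_lcml n M.
rewrite mulnC in lE; rewrite lE -mnl => mla.
exists (multiples (m * l)); first exact: adicU_multiples.
have /dvdnP[k kE] := dvdn_lcmr n M.
move=> x /multiplesE[w xw]; apply/MV/multiplesE; exists (w * k%:Z).
have m0 : (m%:R : rat) != 0 by rewrite pnatr_eq0 -lt0n (pos_divisor_gt0 ma).
have nl : k%:R * M%:R = n%:R * l%:R :> rat by rewrite -!natrM -kE lE.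
rewrite /= xw natrM intrM -[RHS]mulrA [_ * M%:R]nl.
by field.
Qed.

Lemma scaling_extension (Oa : Omega a) (Ob : Omega b) :
  exists2 P : Oa -> Ob, continuous P & forall x, P (hc_in Oa x) = hc_in Ob (scaling x).
Proof. exact: completion_extension scalingB scaling_continuous. Qed.

End Scaling.

Lemma scalingK a b m n (mn : commensurable a b m n) :
  cancel (scaling mn) (scaling (commensurable_sym mn)).
Proof.
have [ma nb _ _] := mn; move=> x; apply: val_inj => /=.
by field; rewrite !pnatr_eq0 -!lt0n (pos_divisor_gt0 ma) (pos_divisor_gt0 nb).
Qed.

Section ScalingExtension.
Variables (a b : adic_seq) (Oa : Omega a) (Ob : Omega b) (m n : nat).
Hypothesis mn : commensurable a b m n.
Variables (P : Oa -> Ob) (Q : Ob -> Oa).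
Hypotheses (cP : continuous P) (cQ : continuous Q).
Hypothesis Pin : forall x, P (hc_in Oa x) = hc_in Ob (scaling mn x).

Lemma scaling_extensionK (mn' : commensurable b a n m) :
  (forall y, Q (hc_in Ob y) = hc_in Oa (scaling mn' y)) -> cancel P Q.
Proof.
move=> Qin; suff E : Q \o P = id by move=> x; exact: (congr1 (@^~ x) E).
apply: continuous_eq_on_N; first exact: hc_hausdorff.
- by move=> x; apply: continuous_comp; [exact: cP|exact: cQ].
- by move=> x; exact: cvg_id.
- move=> x; rewrite /= Pin Qin -[RHS](congr1 (hc_in Oa) (scalingK mn x)).
  (* [mn'] and [commensurable_sym mn] may be different proofs, but the two scalings have equal
     values. *)
  by congr (hc_in Oa _); apply: val_inj.
Qed.

Lemma scaling_extension_subr x y : P (y - hc_in Oa x) = P y - hc_in Ob (scaling mn x).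
Proof.
suff E : P \o (fun y => y - hc_in Oa x) = (fun y => y - hc_in Ob (scaling mn x)) \o P.
  exact: (congr1 (@^~ y) E).
apply: continuous_eq_on_N; first exact: hc_hausdorff.
- by move=> z; apply: continuous_comp; [exact: subr_continuous|exact: cP].
- by move=> z; apply: continuous_comp; [exact: cP|exact: subr_continuous].
- by move=> z; rewrite /= -raddfB !Pin -raddfB scalingB.
Qed.

Variables (H : set rat) (HSa : nontrivial_subgroup_of (adicS a) H).
Variable HSb : nontrivial_subgroup_of (adicS b) H.

(** [h] and [k] are one rational in two types; on [N_a] both sides multiply by [h n / m], and
    density extends the equality. *)
Lemma scaling_extension_mul (h : subgroup_elt HSa) (k : subgroup_elt HSb) x :
  val h = val k -> P (omega_mul h x) = omega_mul k (P x).
Proof.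
move=> hk; suff E : P \o omega_mul h = omega_mul k \o P by exact: (congr1 (@^~ x) E).
have [ch hin] := omega_mulP Oa h; have [ck kin] := omega_mulP Ob k.
apply: continuous_eq_on_N; first exact: hc_hausdorff.
- by move=> z; apply: continuous_comp; [exact: ch|exact: cP].
- by move=> z; apply: continuous_comp; [exact: cP|exact: ck].
- move=> z; rewrite /= hin !Pin kin; congr (hc_in Ob _); apply: val_inj => /=.
  by rewrite -hk mulrCA.
Qed.

End ScalingExtension.

Section Equivariance.
Variables (a b : adic_seq) (H : set rat).
Variables (HSa : nontrivial_subgroup_of (adicS a) H).
Variables (HSb : nontrivial_subgroup_of (adicS b) H).

Definition elt_transfer (h : subgroup_elt HSa) : subgroup_elt HSb :=
  exist _ (val h) (valP h).

Definition sd_scaling m n (mn : commensurable a b m n) (s : semidirect HSa) :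
  semidirect HSb := (scaling mn s.1, elt_transfer s.2).

Lemma sd_scalingM m n (mn : commensurable a b m n) :
  {morph sd_scaling mn : s t / (s * t)%g}.
Proof.
move=> [x h] [y k]; congr (_, _); apply: val_inj => //=.
by rewrite mulrDr [in LHS]mulrCA.
Qed.

End Equivariance.

Lemma sd_scalingK a b m n H (HSa : nontrivial_subgroup_of (adicS a) H)
    (HSb : nontrivial_subgroup_of (adicS b) H)
    (mn : commensurable a b m n) (mn' : commensurable b a n m) :
  cancel (@sd_scaling _ _ _ HSa HSb m n mn) (@sd_scaling _ _ _ HSb HSa n m mn').
Proof.
move=> [x h]; congr (_, _); apply: val_inj => //=.
exact: (congr1 (@N_val a) (scalingK mn x)).
Qed.

Theorem proposition5p10 (R : realType) (a b : adic_seq)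
    (Oa : Omega a) (Ob : Omega b) (Oiso : topgroup_iso Oa Ob) :
  adicS a = adicS b /\
  forall (H : set rat)
    (HSa : nontrivial_subgroup_of (adicS a) H)
    (HSb : nontrivial_subgroup_of (adicS b) H)
    (Qa : Qbar R HSa Oa) (Qb : Qbar R HSb Ob),
    cstar_iso Qa Qb.
Proof.
have [m [n mn]] := topgroup_iso_commensurable Oiso.
split=> [|H HSa HSb Qa Qb]; first exact: commensurable_adicS mn.
have nm := commensurable_sym mn.
have [P cP Pin] := scaling_extension mn Oa Ob.
have [Q cQ Qin] := scaling_extension nm Ob Oa.
have ai : action_iso (@alpha_aff R a H HSa Oa) (@alpha_aff R b H HSb Ob) P Q
    (sd_scaling HSb mn) (sd_scaling HSa nm).
  split=> //.
  - exact: scaling_extensionK Qin.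
  - exact: scaling_extensionK Pin.
  - exact: sd_scalingK.
  - exact: sd_scalingK.
  - exact: sd_scalingM.
  (* [P] turns translation by [t.1] into translation by its scaling and commutes with the inverse of
     [t.2], so both sides evaluate [f] at the same point. *)
  - move=> t f x; rewrite /alpha_aff /= -(scaling_extension_subr cP Pin).
    by congr (f _); apply/esym/(scaling_extension_mul cP Pin).
apply: crossed_product_iso ai _ _ _ _ => [t f|t]; first exact: alpha_aff_C0.
by apply/funext.
Qed.
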